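(* Assume $p=p_n\to\infty$ as $n\to\infty$. Set $$\overline{\Theta}_{\min}=\frac{1}{\alpha_n}\left\{\Theta_{\min}-\arcsin(t_n)\right\}-\ln\big[(p_n-1)(1-t_n^2)\big]$$ and $$\overline{\Theta}_{\max}=\frac{1}{\alpha_n}\left\{\pi-\Theta_{\max}-\arcsin(t_n)\right\}-\ln\big[(p_n-1)(1-t_n^2)\big].$$ Then, as $n\to\infty$, $(\overline{\Theta}_{\min},\overline{\Theta}_{\max})$ converges in distribution to $(Z_1,Z_2)$, where $Z_1$ and $Z_2$ are independent random variables, each with cumulative distribution function $$D(x)=1-\exp\left\{-\frac{1}{2\sqrt{2\pi}}e^{x/2}\right\},\qquad x\in\mathbb{R}.$$
   Context: For each $n\ge 2$ let $p=p_n\ge 2$ be an integer and let $X_1,\ldots,X_n$ be i.i.d. random vectors uniformly distributed on the unit sphere $\mathbb S^{p-1}=\{x\in\mathbb R^p:\|x\|=1\}$ (Euclidean norm). Define $\Theta_{ij}=\arccos(X_i^TX_j)\in[0,\pi]$ for $1\le i<j\le n$, and $\Theta_{\min}=\min_{1\le i<j\le n}\Theta_{ij}$, $\Theta_{\max}=\max_{1\le i<j\le n}\Theta_{ij}$. Set $$t_n=\exp\left\{-\frac{2\ln n}{p_n-1}\right\}\in(0,1),\qquad \alpha_n=\frac{t_n}{2(p_n-1)\sqrt{1-t_n^2}}.$$ *)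

(* Defs.v *)
From HB Require Import structures.
From mathcomp Require Import all_boot all_order all_algebra.
From mathcomp Require Import all_classical all_reals all_analysis.
Import Order.TTheory GRing.Theory Num.Theory.
Import numFieldNormedType.Exports.

Set Implicit Arguments.
Unset Strict Implicit.
Unset Printing Implicit Defensive.

Local Open Scope classical_set_scope.
Local Open Scope ring_scope.

(* Vectors of R^p are p-tuples: their canonical sigma-algebra, generated by the
   coordinates, is the Borel sigma-algebra of R^p. *)

Definition dotp (R : realType) (p : nat) (x y : p.-tuple R) : R :=
  \sum_(k < p) tnth x k * tnth y k.

Definition enorm (R : realType) (p : nat) (x : p.-tuple R) : R :=
  Num.sqrt (dotp x x).

Definition unit_sphere (R : realType) (p : nat) : set (p.-tuple R) :=
  [set x | enorm x = 1].

Definition mxapply (R : realType) (p : nat) (O : 'M[R]_p) (x : p.-tuple R) :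
    p.-tuple R :=
  [tuple \sum_(k < p) O i k * tnth x k | i < p].

Definition orthogonal_mx (R : realType) (p : nat) (O : 'M[R]_p) : Prop :=
  O *m O^T = 1%:M.

(* The uniform law on the sphere is the normalized Haar measure, i.e. the only
   Borel probability carried by the sphere and invariant under O(p). *)
Definition uniform_on_sphere d (T : measurableType d) (R : realType)
    (P : probability T R) (p : nat) (X : {RV P >-> p.-tuple R}) : Prop :=
  distribution P X (@unit_sphere R p) = 1%E /\
  forall O : 'M[R]_p, orthogonal_mx O ->
    forall A : set (p.-tuple R), measurable A ->
      distribution P X (mxapply O @^-1` A) = distribution P X A.

Definition mutually_independent d (T : measurableType d) (R : realType)
    (P : probability T R) d' (T' : measurableType d') (I : finType)
    (X : I -> {RV P >-> T'}) : Prop :=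
  forall (J : {set I}) (A : I -> set T'), (forall i, measurable (A i)) ->
    P (\bigcap_(i in [set` J]) (X i @^-1` A i)) =
    (\prod_(i in J) P (X i @^-1` A i))%E.

Definition independent2 d (T : measurableType d) (R : realType)
    (P : probability T R) (Z1 Z2 : {RV P >-> R}) : Prop :=
  forall A B : set R, measurable A -> measurable B ->
    P (Z1 @^-1` A `&` Z2 @^-1` B) = (P (Z1 @^-1` A) * P (Z2 @^-1` B))%E.

(* Weak convergence of laws; each Y n may live on its own probability space. *)
Definition cvg_in_distribution (R : realType) (E : topologicalType)
    (d : nat -> measure_display) (T : forall n, measurableType (d n))
    (P : forall n, probability (T n) R) (Y : forall n, T n -> E)
    d' (S : measurableType d') (Q : probability S R) (Z : S -> E) : Prop :=
  forall f : E -> R, continuous f -> (exists M : R, forall x, `|f x| <= M) ->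
    ('E_(P n)[f \o Y n])%E @[n --> \oo] --> ('E_Q[f \o Z])%E.

Section Angles.
Context (R : realType) (T : Type) (n p : nat) (X : 'I_n -> T -> p.-tuple R).

Definition angle (i j : 'I_n) (w : T) : R := acos (dotp (X i w) (X j w)).

(* The defaults pi and 0 of the iterated min and max are neutral, since angles
   lie in [0, pi]; they are only returned when there is no pair (n < 2). *)
Definition angle_min (w : T) : R :=
  \big[Num.min/pi]_(ij : 'I_n * 'I_n | (ij.1 < ij.2)%N) angle ij.1 ij.2 w.

Definition angle_max (w : T) : R :=
  \big[Num.max/0]_(ij : 'I_n * 'I_n | (ij.1 < ij.2)%N) angle ij.1 ij.2 w.

Definition t_ : R := expR (- (2 * ln n%:R / (p%:R - 1))).

Definition alpha_ : R := t_ / (2 * (p%:R - 1) * Num.sqrt (1 - t_ ^+ 2)).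

Definition norm_angle_min (w : T) : R :=
  alpha_^-1 * (angle_min w - asin t_) - ln ((p%:R - 1) * (1 - t_ ^+ 2)).

Definition norm_angle_max (w : T) : R :=
  alpha_^-1 * (pi - angle_max w - asin t_) - ln ((p%:R - 1) * (1 - t_ ^+ 2)).

End Angles.

Definition limit_cdf (R : realType) (x : R) : R :=
  1 - expR (- ((2 * Num.sqrt (2 * pi))^-1 * expR (x / 2))).

(* Main.v *)
(* For a point [y] uniform on the sphere and a fixed unit vector [z], the law of
   the dot product is determined by its moments, which rotation invariance
   computes recursively: comparing the coefficients of [t ^ 2] in
   [E (y_0 + t y_j) ^ (2 l) = (1 + t ^ 2) ^ l E y_0 ^ (2 l)] and summing over [j]
   gives the recursion satisfied by the moments of [cos s] under the density
   proportional to [sin s ^ (p - 2)] on [[0, pi]].  Hence a cap of angular radius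
   [a] has measure [J a], the normalized integral of [sin ^ (p - 2)] over [[0, a]],
   and Wallis' formula together with two-sided bounds on that integral gives
   [n ^ 2 J (theta_n x) --> e ^ (x / 2) / sqrt (2 pi)] at the angle
   [theta_n x = arcsin t_n + alpha_n (x + ln ((p - 1) (1 - t_n ^ 2)))].

   The event [min > x, max > y] says that no pair of points is bad, i.e. at angle
   at most [theta_n x] or at least [pi - theta_n y].  Badness of a pair has
   probability [q = J (theta_n x) + J (theta_n y)] and is pairwise independent,
   even conditionally on all points but one.  Revealing the points one by one,
   inclusion-exclusion bounds the probability that the k-th point is bad for none
   of the previous ones, and the probability of having no bad pair equals
   [\prod_(k < n) (1 - k q)] up to [n ^ 3 q ^ 2].  This tends to
   [exp (- lim n ^ 2 q / 2)], the product of the tails of the two limit laws.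
   Joint tails determine weak convergence by approximating a bounded continuous
   function with step functions on a grid. *)
From HB Require Import structures.
Require Import Defs.
From mathcomp Require Import all_boot all_order all_algebra.
From mathcomp Require Import ring lra zify.
From mathcomp Require Import all_classical all_reals all_analysis measurable_realfun.
Import Order.TTheory GRing.Theory Num.Theory.
Import numFieldNormedType.Exports.

Set Implicit Arguments.
Unset Strict Implicit.
Unset Printing Implicit Defensive.
Local Open Scope classical_set_scope.
Local Open Scope ring_scope.

(** * The law of a dot product *)

(** Uniformity is given only as invariance under O(p), so the dot product comes without a density.
    Its moments give integrals of polynomials; the passage to caps uses explicit polynomials that
    stay bounded and converge at every point of [-1, 1] to the indicator of a half-line, jump
    included, so that dominated convergence suffices.

    The relative growth of [p n] and ln n is arbitrary: t_n may approach 0, 1 or neither. In all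
    regimes v = (p - 1)(1 - t_n ^ 2) tends to infinity, and the errors of the expansion around b =
    arcsin t_n are controlled by (x + ln v) ^ 2 / v and 1 / v. Two cancellations explain the
    normalization: n ^ 2 t_n ^ (p - 1) = 1 removes the number of pairs, and the shift by ln v
    produces sqrt v = sqrt (p - 1) cos b, which compensates the denominator (p - 1) cos of the cap
    integral and the decay of Wallis' integral.

    In the limit q has order n ^ -2, so n ^ 3 q ^ 2 has order 1 / n: inclusion-exclusion can be cut
    at second order. *)

Section dot_product.
Context {R : realType} {p : nat}.
Implicit Types x y z : p.-tuple R.

Lemma dotpC x y : dotp x y = dotp y x.
Proof. by apply: eq_bigr => k _; rewrite mulrC. Qed.

Lemma dotp_ge0 x : 0 <= dotp x x.
Proof. by apply: sumr_ge0 => k _; rewrite -expr2 sqr_ge0. Qed.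

Lemma unit_sphereP x : unit_sphere x <-> dotp x x = 1.
Proof.
rewrite /unit_sphere /= /enorm; split => [h|->]; last by rewrite sqrtr1.
by rewrite -(sqr_sqrtr (dotp_ge0 x)) h expr1n.
Qed.

(** The Householder reflection along [v] = z - z' exchanges z and z' and is symmetric, so it can be
    moved from y to z. When z = z' it degenerates and the identity serves. *)
Lemma reflection_exists z z' : unit_sphere z -> unit_sphere z' ->
  exists2 O : 'M[R]_p, orthogonal_mx O &
    forall y, dotp z (mxapply O y) = dotp z' y.
Proof.
move=> /unit_sphereP z1 /unit_sphereP z'1.
pose v : 'rV[R]_p := \row_k (tnth z k - tnth z' k).
pose s : R := \sum_k v 0 k ^+ 2.
have [s0|s0] := eqVneq s 0.
  exists 1%:M; first by rewrite /orthogonal_mx trmx1 mulmx1.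
  have zz' k : tnth z k = tnth z' k.
    move/eqP: s0; rewrite psumr_eq0 => [/allP/(_ k)|i _].
      by rewrite mem_index_enum /v mxE sqrf_eq0 subr_eq0 => /(_ isT)/eqP.
    exact: sqr_ge0.
  move=> y; apply: eq_bigr => k _; rewrite zz'; congr (_ * _).
  rewrite tnth_mktuple (bigD1 k)//= big1 ?addr0 => [|i ik].
    by rewrite mxE eqxx mul1r.
  by rewrite mxE eq_sym (negbTE ik) mul0r.
have vv : v *m v^T = s%:M.
  apply/matrixP => i j; rewrite !mxE !ord1 eqxx mulr1n.
  by apply: eq_bigr => k _; rewrite !mxE expr2.
exists (1%:M - (2 / s) *: (v^T *m v)).
  rewrite /orthogonal_mx.
  have -> : (1%:M - (2 / s) *: (v^T *m v))^T = 1%:M - (2 / s) *: (v^T *m v).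
    apply/matrixP => i j; rewrite !mxE !big_ord1 !mxE eq_sym.
    by rewrite (mulrC (tnth z i - _)).
  rewrite mulmxBl !mul1mx mulmxBr mulmx1.
  rewrite -scalemxAl -scalemxAr mulmxA -(mulmxA v^T) vv.
  rewrite -mulmxA mul_scalar_mx -scalemxAr !scalerA.
  rewrite opprB addrA -[RHS]addr0 -!addrA; congr (_ + _).
  rewrite -scalerBl addrC -scalerBl (_ : _ - _ = 0) ?scale0r//.
  by field.
move=> y.
have -> : dotp z (mxapply (1%:M - (2 / s) *: (v^T *m v)) y) =
    dotp z y - 2 / s * ((\sum_k tnth z k * v 0 k) * \sum_k v 0 k * tnth y k).
  rewrite /dotp mulr_suml mulr_sumr -sumrB; apply: eq_bigr => k _.
  rewrite tnth_mktuple.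
  rewrite (_ : \sum_i _ = tnth y k - 2 / s * (v 0 k * \sum_i v 0 i * tnth y i)).
    by ring.
  rewrite [X in _ = X - _](_ : _ = \sum_i (k == i)%:R * tnth y i); last first.
    rewrite (bigD1 k)//= eqxx mul1r big1 ?addr0// => i ik.
    by rewrite eq_sym (negbTE ik) mul0r.
  rewrite mulr_sumr mulr_sumr -sumrB; apply: eq_bigr => i _.
  by rewrite !mxE big_ord1 !mxE; ring.
(* For unit vectors |z - z'| ^ 2 = 2 - 2 z.z', twice z.(z - z'); this is what makes the coefficient
   2 / s produce exactly z'. *)
have zv : \sum_k tnth z k * v 0 k = s / 2.
  have -> : s = dotp z z + dotp z' z' - 2 * dotp z z'.
    rewrite /dotp mulr_sumr -big_split -sumrB; apply: eq_bigr => k _.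
    by rewrite mxE /=; ring.
  have -> : \sum_k tnth z k * v 0 k = dotp z z - dotp z z'.
    by rewrite /dotp -sumrB; apply: eq_bigr => k _; rewrite mxE; ring.
  by rewrite z1 z'1; field.
rewrite zv (_ : \sum_k _ = dotp z y - dotp z' y); last first.
  by rewrite /dotp -sumrB; apply: eq_bigr => k _; rewrite mxE; ring.
by field.
Qed.

Lemma measurable_dotpr z : measurable_fun setT (dotp z).
Proof.
apply: measurable_sum => k; apply: measurable_funM => //.
exact: measurable_tnth.
Qed.

Lemma measurable_dotp :
  measurable_fun setT (fun xy : p.-tuple R * p.-tuple R => dotp xy.1 xy.2).
Proof.
apply: measurable_sum => k; apply: measurable_funM.
  exact: (measurableT_comp (measurable_tnth k) measurable_fst).
exact: (measurableT_comp (measurable_tnth k) measurable_snd).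
Qed.

Lemma measurable_unit_sphere : measurable (@unit_sphere R p).
Proof.
rewrite (_ : @unit_sphere R p = (fun x => dotp x x) @^-1` [set 1]).
  rewrite -[_ @^-1` _]setTI.
  have mf : measurable_fun setT (fun x : p.-tuple R => dotp x x).
    apply: measurable_sum => k; apply: measurable_funM; exact: measurable_tnth.
  exact: mf.
by apply/seteqP; split => x /unit_sphereP.
Qed.

Lemma measurable_mxapply (O : 'M[R]_p) : measurable_fun setT (mxapply O).
Proof.
apply/measurable_fun_tnthP => i.
rewrite (_ : _ \o _ = fun y => \sum_(k < p) O i k * tnth y k); last first.
  by apply/funext => y /=; rewrite tnth_mktuple.
apply: measurable_sum => k; apply: measurable_funM => //.
exact: measurable_tnth.
Qed.

Lemma dotp_sphere_bound x y : unit_sphere x -> unit_sphere y ->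
  -1 <= dotp x y <= 1.
Proof.
move=> /unit_sphereP x1 /unit_sphereP y1.
(* Cauchy-Schwarz for unit vectors: |x + c y| ^ 2 is nonnegative for c = 1 and c = -1. *)
have h (c : R) : c ^+ 2 = 1 -> 0 <= 2 + 2 * c * dotp x y.
  move=> c2; have -> : 2 + 2 * c * dotp x y =
      \sum_(k < p) (tnth x k + c * tnth y k) ^+ 2.
    have -> : 2 + 2 * c * dotp x y =
        dotp x x + 2 * c * dotp x y + c ^+ 2 * dotp y y.
      by rewrite x1 y1 c2; ring.
    rewrite /dotp !mulr_sumr -!big_split /=; apply: eq_bigr => k _.
    by ring.
  by apply: sumr_ge0 => k _; exact: sqr_ge0.
have := h 1 (expr1n _ _); have := h (-1); rewrite sqrrN expr1n => /(_ erefl).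
lra.
Qed.

Lemma sphere_coord_bound y k : unit_sphere y -> `|tnth y k| <= 1.
Proof.
move=> /unit_sphereP; rewrite /dotp (bigD1 k)//= => h.
rewrite -(@ler_pXn2r _ 2)// ?nnegrE// expr1n real_normK ?num_real// -h expr2.
rewrite lerDl; apply: sumr_ge0 => i _; rewrite -expr2 sqr_ge0//.
Qed.

End dot_product.

(** [uniform_on_sphere] restated for a law, so that the underlying probability space is forgotten
    until independence is used. *)
Definition rotation_invariant (R : realType) (p : nat)
    (mu : probability (p.-tuple R) R) :=
  mu (@unit_sphere R p) = 1%E /\
  forall O : 'M[R]_p, orthogonal_mx O ->
    forall A : set (p.-tuple R), measurable A -> mu (mxapply O @^-1` A) = mu A.

Section invariant_law.
Context {R : realType} {p : nat} {mu : probability (p.-tuple R) R}.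
Hypothesis mu_inv : rotation_invariant mu.
Local Notation S := (@unit_sphere R p).

Lemma dotp_law z z' B : S z -> S z' -> measurable B ->
  mu (dotp z @^-1` B) = mu (dotp z' @^-1` B).
Proof.
move=> Sz Sz' mB; have [U Uorth zU] := reflection_exists Sz Sz'.
have mzB : measurable (dotp z @^-1` B).
  by rewrite -[_ @^-1` _]setTI; exact: measurable_dotpr.
rewrite -(mu_inv.2 U Uorth _ mzB).
by congr (mu _); apply/seteqP; split => y /=; rewrite zU.
Qed.

Lemma sphere_ae : {ae mu, forall y, S y}.
Proof.
have mS := @measurable_unit_sphere R p.
exists (~` S); split => //; first exact: measurableC.
by have := probability_setC mu mS; rewrite mu_inv.1 subee.
Qed.

Lemma sphere_integral f : measurable_fun setT f ->
  (\int[mu]_(y in S) f y = \int[mu]_y f y)%E.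
Proof.
have mS := @measurable_unit_sphere R p.
move=> mf; rewrite integral_mkcond; apply: ae_eq_integral => //.
  by apply/(measurable_restrict _ _ _).1 => //; exact: measurable_funTS.
have := sphere_ae; apply: filterS => y Sy _.
by rewrite patchE mem_set.
Qed.

Lemma sphere_integral_dotp z z' (f : R -> R) : S z -> S z' ->
  measurable_fun setT f -> (exists M, forall u, `|f u| <= M) ->
  \int[mu]_(y in S) f (dotp z y) = \int[mu]_(y in S) f (dotp z' y).
Proof.
move=> Sz Sz' mf [M fM]; have [U Uorth zU] := reflection_exists Sz Sz'.
have mU := measurable_mxapply U.
have mfd x : measurable_fun setT (fun y : p.-tuple R => (f (dotp x y))%:E).
  apply/measurable_EFinP; apply: (measurableT_comp mf).
  exact: measurable_dotpr.
rewrite /Rintegral !sphere_integral//; congr fine.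
transitivity (\int[pushforward mu (mxapply U)]_y (f (dotp z y))%:E)%E.
  by apply: eq_measure_integral => A mA _; exact/esym/(mu_inv.2 U Uorth A mA).
rewrite integral_pushforward//=.
  by apply: eq_integral => y _; rewrite zU.
rewrite preimage_setT.
apply: (@measurable_bounded_integrable _ _ _ mu
  (fun y => f (dotp z (mxapply U y)))) => //.
- by rewrite [X in (X < _)%E]probability_setT ltry.
- apply: (measurableT_comp mf); apply: (measurableT_comp _ mU).
  exact: measurable_dotpr.
- exists M; split; rewrite ?num_real// => N MN x _ /=.
  by rewrite (le_trans (fM _))// ltW.
Qed.

End invariant_law.

(** A nonzero difference would vanish at 0, 1, 2, ..., which are distinct, hence have more roots
    than its degree allows. *)
Lemma eq_horner_poly (R : numDomainType) (P Q : {poly R}) :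
  (forall t, P.[t] = Q.[t]) -> P = Q.
Proof.
move=> PQ; apply/eqP; rewrite -subr_eq0; apply/negPn/negP => D0.
set D := P - Q in D0 *.
pose rs : seq R := [seq i%:R | i <- iota 0 (size D)].
suff : (size rs < size D)%N by rewrite size_map size_iota ltnn.
apply: max_poly_roots => //.
  by apply/allP => x _; rewrite rootE /D hornerD hornerN PQ subrr.
by rewrite map_inj_uniq ?iota_uniq// => i j /eqP; rewrite eqr_nat => /eqP.
Qed.

Lemma integrable_scale d (T : measurableType d) (R : realType)
    (mu : {measure set T -> \bar R}) (D : set T) (c : R) (f : T -> R) :
  measurable D -> mu.-integrable D (EFin \o f) ->
  mu.-integrable D (EFin \o fun x => c * f x).
Proof. by move=> mD /(integrableZl mD c); exact: eq_integrable. Qed.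

Lemma Rintegral_sum d (T : measurableType d) (R : realType)
    (mu : {measure set T -> \bar R}) (D : set T) (I : Type) (s : seq I)
    (f : I -> T -> R) : measurable D ->
  (forall i, mu.-integrable D (EFin \o f i)) ->
  \int[mu]_(x in D) (\sum_(i <- s) f i x) = \sum_(i <- s) \int[mu]_(x in D) f i x.
Proof.
move=> mD fi; elim: s => [|i s ih].
  rewrite big_nil -[RHS](mul0r (fine (mu D))) -Rintegral_cst//.
  by apply: eq_Rintegral => x _; rewrite big_nil.
rewrite big_cons -ih -RintegralD//; last first.
  rewrite [X in _.-integrable _ X](_ : _ =
      fun x => (\sum_(i <- s) (f i x)%:E)%E).
    by apply: integrable_sum => // j _; exact: fi.
  by apply/funext => x /=; rewrite sumEFin.
by apply: eq_Rintegral => x _; rewrite big_cons.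
Qed.

(** * Moments of a coordinate of a uniform point *)

Section moments.
Context {R : realType} {p : nat} {mu : probability (p.-tuple R) R}.
Hypothesis mu_inv : rotation_invariant mu.
Local Notation S := (@unit_sphere R p).
Variable i0 : 'I_p.

Lemma sphere_integrable (h : p.-tuple R -> R) : measurable_fun setT h ->
  (exists M, forall y, S y -> `|h y| <= M) -> mu.-integrable S (EFin \o h).
Proof.
move=> mh [M hM]; apply: measurable_bounded_integrable.
- exact: measurable_unit_sphere.
- by rewrite [X in (X < _)%E]mu_inv.1 ltry.
- exact: measurable_funTS.
- exists M; split; rewrite ?num_real// => N MN x Sx /=.
  by rewrite (le_trans (hM _ Sx))// ltW.
Qed.

Lemma sphere_integrable_monomial j k l :
  mu.-integrable S (EFin \o fun y => tnth y i0 ^+ k * tnth y j ^+ l).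
Proof.
apply: sphere_integrable.
  apply: measurable_funM; apply: measurable_funX; exact: measurable_tnth.
exists 1 => y Sy; rewrite normrM !normrX.
by rewrite mulr_ile1 ?exprn_ge0 ?exprn_ile1 ?sphere_coord_bound.
Qed.

Definition moment k := \int[mu]_(y in S) (tnth y i0 ^+ k).

Let e (i : 'I_p) : p.-tuple R := [tuple (k == i)%:R | k < p].

Let dotpe i y : dotp (e i) y = tnth y i.
Proof.
rewrite /dotp (bigD1 i)//= tnth_mktuple eqxx mul1r big1 ?addr0// => k ki.
by rewrite tnth_mktuple (negbTE ki) mul0r.
Qed.

Let unit_e i : S (e i).
Proof. by apply/unit_sphereP; rewrite dotpe tnth_mktuple eqxx. Qed.

Lemma moment_dotp z k : S z -> \int[mu]_(y in S) (dotp z y ^+ k) = moment k.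
Proof.
(* Invariance of integrals is available for functions bounded on the whole line, so the power is
   truncated to [-1, 1]; dot products of unit vectors never leave that interval. *)
move=> Sz; pose f (u : R) := (Num.max (-1) (Num.min 1 u)) ^+ k.
have mf : measurable_fun setT f.
  apply: measurable_funX; apply: measurable_maxr => //.
  exact: measurable_minr.
have fb : exists M, forall u, `|f u| <= M.
  exists 1 => u; rewrite normrX exprn_ile1// ler_norml; apply/andP; split.
    by rewrite le_max lexx.
  by rewrite ge_max ge_min lexx /= andbT; lra.
have fE u : -1 <= u <= 1 -> f u = u ^+ k.
  by case/andP=> ? ?; rewrite /f min_r// max_r.
transitivity (\int[mu]_(y in S) f (dotp z y)).
  by apply: eq_Rintegral => y /[!inE] Sy; rewrite fE// dotp_sphere_bound.
rewrite (sphere_integral_dotp mu_inv Sz (unit_e i0) mf fb).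
apply: eq_Rintegral => y /[!inE] Sy.
by rewrite fE ?dotpe// -dotpe dotp_sphere_bound.
Qed.

Lemma moment0 : moment 0 = 1.
Proof.
rewrite /moment; under eq_Rintegral do rewrite expr0.
rewrite Rintegral_cst ?mul1r; last exact: measurable_unit_sphere.
by rewrite [X in fine X]mu_inv.1.
Qed.

(** The coordinate and its opposite are dot products with two unit vectors, hence have the same
    moments. *)
Lemma moment_odd k : odd k -> moment k = 0.
Proof.
move=> ok; pose z : p.-tuple R := [tuple - (j == i0)%:R | j < p].
have zE y : dotp z y = - tnth y i0.
  rewrite -dotpe /dotp -sumrN; apply: eq_bigr => j _.
  by rewrite !tnth_mktuple mulNr.
have Sz : S z.
  by apply/unit_sphereP; rewrite zE tnth_mktuple eqxx opprK.
have := moment_dotp k Sz.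
rewrite (@eq_Rintegral _ _ _ mu S (fun y => -1 * tnth y i0 ^+ k)); last first.
  by move=> y _; rewrite zE exprNn -signr_odd ok expr1.
rewrite RintegralZl//; [|exact: measurable_unit_sphere|].
  by rewrite -/(moment k); lra.
apply: eq_integrable (sphere_integrable_monomial i0 k 0) => //.
  exact: measurable_unit_sphere.
by move=> y _ /=; rewrite expr0 mulr1.
Qed.

Lemma moment_mixed l j : j != i0 ->
  (l.*2.+1)%:R * \int[mu]_(y in S) (tnth y i0 ^+ l.*2 * tnth y j ^+ 2) =
  moment l.*2.+2.
Proof.
move=> ji0; pose n := l.*2.+2.
pose m i := \int[mu]_(y in S) (tnth y i0 ^+ (n - i) * tnth y j ^+ i).
pose P := \poly_(i < n.+1) ('C(n, i)%:R * m i).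
pose Q := moment n *: (1 + 'X^2) ^+ l.+1.
have PQ : P = Q.
  apply: eq_horner_poly => t; rewrite horner_poly hornerZ !hornerE.
  have t0 : 0 < 1 + t ^+ 2 by rewrite ltr_pwDl// sqr_ge0.
  pose s := Num.sqrt (1 + t ^+ 2).
  have s2 : s ^+ 2 = 1 + t ^+ 2 by rewrite sqr_sqrtr// ltW.
  have s0 : s != 0 by rewrite gt_eqF// sqrtr_gt0.
  (* The unit vector (e_0 + t e_j) / sqrt (1 + t ^ 2); clearing the root in its moment of even order
     [n] leaves an identity between polynomials in t. *)
  pose z : p.-tuple R := [tuple ((k == i0)%:R + t * (k == j)%:R) / s | k < p].
  have zE y : dotp z y = (tnth y i0 + t * tnth y j) / s.
    rewrite -!dotpe /dotp mulr_sumr -big_split mulr_suml; apply: eq_bigr => k _.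
    by rewrite !tnth_mktuple /=; ring.
  have Sz : S z.
    apply/unit_sphereP; rewrite zE !tnth_mktuple !eqxx (negbTE ji0).
    rewrite eq_sym (negbTE ji0) mulr1 mulr0 addr0 add0r.
    rewrite (_ : true%:R = 1)//.
    transitivity ((1 + t ^+ 2) / s ^+ 2); first by field.
    by rewrite s2 divff// gt_eqF.
  rewrite -(moment_dotp n Sz).
  rewrite (_ : (_ + _) ^+ l.+1 = s ^+ n); last first.
    by rewrite -s2 -exprM /n -doubleS -mul2n.
  rewrite -RintegralZr//.
  - transitivity (\sum_(i < n.+1) \int[mu]_(y in S)
        ('C(n, i)%:R * t ^+ i * (tnth y i0 ^+ (n - i) * tnth y j ^+ i))).
      apply: eq_bigr => i _; rewrite RintegralZl -/(m i)//; first by ring.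
        exact: measurable_unit_sphere.
      exact: sphere_integrable_monomial.
    rewrite -Rintegral_sum//; last 2 first.
    + exact: measurable_unit_sphere.
    + move=> i; apply: integrable_scale; first exact: measurable_unit_sphere.
      exact: sphere_integrable_monomial.
    apply: eq_Rintegral => y _.
    rewrite zE expr_div_n divfK ?expf_neq0// exprDn.
    by apply: eq_bigr => i _; rewrite exprMn -mulr_natl; ring.
  - exact: measurable_unit_sphere.
  - apply: sphere_integrable.
      apply: measurable_funX; exact: measurable_dotpr.
    exists 1 => y Sy; rewrite normrX exprn_ile1// ler_norml.
    exact: dotp_sphere_bound.
have := congr1 (fun P : {poly R} => P`_2) PQ.
rewrite coef_poly /= coefZ exprDn coef_sum.
rewrite (bigD1 (inord 1))//= inordK// big1 => [|i]; last first.
  rewrite expr1n mul1r coefMn -exprM coefXn -val_eqE/= inordK// => i1.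
  case: eqP => [|_]; last by rewrite mul0rn.
  by move=> h; move: i1; rewrite -(eqn_pmul2l (isT : 0 < 2)%N) -h eqxx.
rewrite expr1n mul1r coefMn -exprM coefXn/= bin1 addr0 /m.
have -> : (n - 2)%N = l.*2 by rewrite /n subn2.
have -> : 'C(n, 2)%:R = l.+1%:R * l.*2.+1%:R :> R.
  by rewrite bin2 (_ : n = l.+1.*2)// -doubleMl doubleK natrM.
(* The coefficients of t ^ 2 are C(2l + 2, 2) = (l + 1)(2l + 1) on one side and l + 1 on the other;
   l + 1 cancels. *)
rewrite -mulrA mulr1n [RHS]mulrC => /mulfI; apply.
by rewrite pnatr_eq0.
Qed.

(** Insert sum_j y_j ^ 2 = 1 in the moment of order 2l. The term j = i0 is the next moment itself,
    with coefficient 2l + 1; each of the p - 1 others gives it once by [moment_mixed]. *)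
Lemma moment_step l :
  (l.*2 + p)%:R * moment l.*2.+2 = (l.*2.+1)%:R * moment l.*2.
Proof.
have mS := @measurable_unit_sphere R p.
have -> : moment l.*2 = \sum_(j < p)
    \int[mu]_(y in S) (tnth y i0 ^+ l.*2 * tnth y j ^+ 2).
  rewrite -Rintegral_sum//; last by move=> j; exact: sphere_integrable_monomial.
  apply: eq_Rintegral => y /[!inE] /unit_sphereP y1.
  rewrite -mulr_sumr; under eq_bigr do rewrite expr2.
  by rewrite -/(dotp y y) y1 mulr1.
rewrite mulr_sumr (bigD1 i0)//= (eq_bigr (fun=> moment l.*2.+2)); last first.
  by move=> j; exact: moment_mixed.
rewrite sumr_const cardC1 card_ord.
under eq_Rintegral do rewrite -exprD addn2.
rewrite -/(moment _) -[_ *+ p.-1]mulr_natl -mulrDl -natrD; congr (_%:R * _).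
by move: i0; case: (p) => [[]//|q _]; lia.
Qed.

End moments.

(** * Powers of sine and cosine *)

Section calculus.
Context {R : realType}.
Local Notation mu := (@lebesgue_measure R).
Implicit Types (F f g : R -> R) (a b : R).

Lemma continuous_itv_integrable f a b : {in `[a, b], continuous f} ->
  mu.-integrable `[a, b] (EFin \o f).
Proof.
move=> cf; apply: continuous_compact_integrable; first exact: segment_compact.
by apply: continuous_in_subspaceT => x; rewrite inE => /cf.
Qed.

Lemma Rintegral_derive F f a b : a < b ->
  (forall x, x \in `[a, b] -> is_derive x 1 F (f x)) ->
  {in `[a, b], continuous f} ->
  \int[mu]_(x in `[a, b]) f x = F b - F a.
Proof.
move=> ab dF cf.
have cF x : x \in `[a, b] -> {for x, continuous F}.
  by move=> /dF ?; apply: differentiable_continuous; exact/derivable1_diffP.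
rewrite /Rintegral (@continuous_FTC2 R f F)//.
- by apply: continuous_in_subspaceT => x; rewrite inE => /cf.
- split.
  + by move=> x xab; have := dF x (subset_itv_oo_cc xab) => ?; exact: ex_derive.
  + by apply: cvg_at_right_filter; apply: cF; rewrite in_itv/= lexx ltW.
  + by apply: cvg_at_left_filter; apply: cF; rewrite in_itv/= lexx ltW.
- move=> x xab; have := dF x (subset_itv_oo_cc xab) => ?.
  by rewrite derive1E derive_val.
Qed.

Lemma continuous_sinX n : continuous (fun x : R => sin x ^+ n).
Proof.
move=> x; apply: (@continuous_comp _ _ _ sin (fun u => u ^+ n)).
  exact: continuous_sin.
exact: exprn_continuous.
Qed.

Lemma continuous_cosX n : continuous (fun x : R => cos x ^+ n).
Proof.
move=> x; apply: (@continuous_comp _ _ _ cos (fun u => u ^+ n)).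
  exact: continuous_cos.
exact: exprn_continuous.
Qed.

Lemma continuous_cosXsinX k n : continuous (fun x : R => cos x ^+ k * sin x ^+ n).
Proof.
move=> x; apply: (@continuousM _ _ (fun x => cos x ^+ k) (fun x => sin x ^+ n)).
  exact: continuous_cosX.
exact: continuous_sinX.
Qed.

Lemma is_derive_sinX n (x : R) :
  is_derive x 1 (fun x => sin x ^+ n.+1) (n.+1%:R * (cos x * sin x ^+ n)).
Proof.
have := is_deriveX n.+1 (is_derive_sin x).
rewrite exprfctE => h; apply: is_derive_eq h _.
by rewrite -mulr_natl -[_ *: _]/(_ * _) /=; ring.
Qed.

Lemma is_derive_cosX n (x : R) :
  is_derive x 1 (fun x => cos x ^+ n.+1) (- (n.+1%:R * (cos x ^+ n * sin x))).
Proof.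
have := is_deriveX n.+1 (is_derive_cos x).
rewrite exprfctE => h; apply: is_derive_eq h _.
by rewrite -mulr_natl -[_ *: _]/(_ * _) /=; ring.
Qed.

Lemma continuous_scale (c : R) f (x : R) :
  {for x, continuous f} -> {for x, continuous (fun x => c * f x)}.
Proof. by move=> cf; apply: cvgM => //; exact: cvg_cst. Qed.

Definition cos_sin_int k n : R := \int[mu]_(x in `[0, pi]) (cos x ^+ k * sin x ^+ n).

Lemma cos_sin_integrable k n :
  mu.-integrable `[0, pi] (EFin \o fun x : R => cos x ^+ k * sin x ^+ n).
Proof. by apply: continuous_itv_integrable => x _; exact: continuous_cosXsinX. Qed.

Let piP : (0 : R) < pi := pi_gt0 R.
Let mI : measurable (`[0, pi]%classic : set R).
Proof. exact: measurable_itv. Qed.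

Lemma cos_sin_int1 n : cos_sin_int 1 n = 0.
Proof.
have d (x : R) : x \in `[0, pi] ->
    is_derive x 1 (fun x => sin x ^+ n.+1) (n.+1%:R * (cos x ^+ 1 * sin x ^+ n)).
  by move=> _; rewrite expr1; exact: is_derive_sinX.
have := Rintegral_derive piP d.
rewrite RintegralZl//; last exact: cos_sin_integrable.
rewrite sinpi sin0 !expr0n /= subr0 => h.
have : n.+1%:R * cos_sin_int 1 n = 0.
  apply: h => x _.
  exact: (continuous_scale (@continuous_cosXsinX 1 n x)).
by move=> /eqP; rewrite mulf_eq0 pnatr_eq0/= => /eqP.
Qed.

Lemma is_derive_cosXsinX k n (x : R) :
  is_derive x 1 (fun x => cos x ^+ k.+1 * sin x ^+ n.+1)
    ((k + n.+2)%:R * (cos x ^+ k.+2 * sin x ^+ n) -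
     k.+1%:R * (cos x ^+ k * sin x ^+ n)).
Proof.
have := is_deriveM (is_derive_cosX k x) (is_derive_sinX n x).
move=> h; apply: is_derive_eq h _.
rewrite -![_ *: _]/(_ * _).
have -> : sin x ^+ n.+1 = sin x ^+ n * sin x by rewrite exprS mulrC.
have -> : (k + n.+2)%:R = k.+1%:R + n.+1%:R :> R by rewrite -natrD; congr _%:R; lia.
have -> : cos x ^+ k.+2 = cos x ^+ k * (1 - sin x ^+ 2).
  by rewrite -cos2sin2 -exprD addn2.
have -> : cos x ^+ k.+1 = cos x ^+ k * cos x by rewrite exprS mulrC.
ring: (cos2sin2 x).
Qed.

(** The function cos ^ (k + 1) sin ^ (n + 1) vanishes at 0 and pi, so its derivative integrates to
    0. With n = p - 2 and k even this is the recursion of [moment_step]. *)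
Lemma cos_sin_int_step k n :
  (k + n.+2)%:R * cos_sin_int k.+2 n = k.+1%:R * cos_sin_int k n.
Proof.
have := Rintegral_derive piP (fun x _ => is_derive_cosXsinX k n x).
rewrite RintegralB//; last 2 first.
- exact/integrable_scale/cos_sin_integrable.
- exact/integrable_scale/cos_sin_integrable.
rewrite !RintegralZl//; try exact: cos_sin_integrable.
rewrite sinpi sin0 !expr0n /= !mulr0 subr0 => h.
apply/eqP; rewrite -subr_eq0; apply/eqP; apply: h => x _.
exact: (cvgB (continuous_scale (@continuous_cosXsinX k.+2 n x))
             (continuous_scale (@continuous_cosXsinX k n x))).
Qed.

Definition wallis n : R := \int[mu]_(x in `[0, pi]) (sin x ^+ n).

Lemma wallisE n : wallis n = cos_sin_int 0 n.
Proof. by apply: eq_Rintegral => x _; rewrite expr0 mul1r. Qed.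

Lemma sinX_integrable n a b :
  mu.-integrable `[a, b] (EFin \o fun x : R => sin x ^+ n).
Proof. by apply: continuous_itv_integrable => x _; exact: continuous_sinX. Qed.

Lemma wallis_step n : n.+2%:R * wallis n.+2 = n.+1%:R * wallis n.
Proof.
have := cos_sin_int_step 0 n; rewrite add0n mul1r -!wallisE => h.
have -> : wallis n.+2 = wallis n - cos_sin_int 2 n.
  rewrite wallisE /cos_sin_int -RintegralB//.
  - apply: eq_Rintegral => x _.
    by rewrite expr0 mul1r -addn2 exprD sin2cos2; ring.
  - exact: sinX_integrable.
  - exact: cos_sin_integrable.
rewrite mulrBr h -natr1 mulrDl mul1r; ring.
Qed.

Lemma wallis0 : wallis 0 = pi.
Proof.
rewrite /wallis; under eq_Rintegral do rewrite expr0.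
rewrite Rintegral_cst// mul1r.
by rewrite [X in fine X](lebesgue_measure_itv `[0, pi])/= lte_fin piP -EFinB subr0.
Qed.

Lemma wallis1 : wallis 1 = 2.
Proof.
have d (x : R) : x \in `[0, pi] -> is_derive x 1 (fun x => - cos x) (sin x).
  by move=> _; apply: is_derive_eq; rewrite opprK.
have := Rintegral_derive piP d (fun x _ => @continuous_sin R x).
by rewrite cospi cos0 !opprK (_ : 1 + 1 = 2)// => <-.
Qed.

(** By [wallis_step] the left-hand side does not depend on n. It stands in for the closed forms of
    Wallis' integrals, both for positivity and for asymptotics. *)
Lemma wallis_mul n : wallis n * wallis n.+1 * n.+1%:R = 2 * pi.
Proof.
elim: n => [|n ih]; first by rewrite wallis0 wallis1 mulr1 mulrC.
rewrite -ih -mulrA [X in _ * X]mulrC wallis_step; ring.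
Qed.

Lemma wallis_gt0 n : 0 < wallis n.
Proof.
have w0 k : 0 <= wallis k.
  apply: Rintegral_ge0 => x /=; rewrite in_itv/= => /sin_ge0_pi s0.
  exact: exprn_ge0.
rewrite lt_neqAle w0 andbT; apply/negP => /eqP w.
have := wallis_mul n; rewrite -w !mul0r => /esym/eqP.
by rewrite mulf_eq0 pnatr_eq0/= gt_eqF.
Qed.

Lemma wallis_le n : wallis n.+1 <= wallis n.
Proof.
apply: le_Rintegral => //; try exact: sinX_integrable.
move=> x /=; rewrite in_itv/= => /sin_ge0_pi s0.
by rewrite exprS ler_piMl ?exprn_ge0 ?sin_le1.
Qed.

End calculus.

(** * Polynomials converging to the indicator of a half-line *)

Section threshold_polynomials.
Context {R : realType}.
Implicit Types (w r : R).

(** With s = sqrt r, each term of 1 + s + ... + s ^ (n - 1) is at least s ^ n, so n s ^ n <= 1 / (1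
    - s). One factor s ^ n is left over for the decay. *)
Lemma cvg_natX r : 0 <= r < 1 -> (n%:R * r ^+ n) @[n --> \oo] --> (0 : R).
Proof.
move=> /andP[r0 r1]; pose s := Num.sqrt r.
have s0 : 0 <= s by exact: sqrtr_ge0.
have s1 : s < 1 by rewrite -sqrtr1 ltr_sqrt.
have h n : n%:R * s ^+ n * (1 - s) <= 1 - s ^+ n.
  elim: n => [|n ih]; first by rewrite !mul0r expr0 subrr.
  have sn : 0 <= s ^+ n by exact: exprn_ge0.
  apply: (@le_trans _ _ (n.+1%:R * s ^+ n * (1 - s))).
    rewrite ler_wpM2r ?subr_ge0 ?(ltW s1)// ler_wpM2l// exprS ler_piMl// ltW//.
  by rewrite -natr1 exprS; nra.
have rE n : r ^+ n = s ^+ n * s ^+ n by rewrite -exprMn -expr2 sqr_sqrtr.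
apply: (@squeeze_cvgr _ _ _ _ (fun=> 0) (geometric (1 - s)^-1 s)).
- near=> n; rewrite mulr_ge0 ?exprn_ge0//= rE mulrA ler_wpM2r ?exprn_ge0//.
  rewrite -[leRHS]mul1r ler_pdivlMr ?subr_gt0// (le_trans (h n))//.
  by rewrite gerBl exprn_ge0.
- exact: cvg_cst.
- by apply: cvg_geometric; rewrite ger0_norm.
Unshelve. all: by end_near. Qed.

Lemma bernoulli_ge w k : 0 <= w <= 1 -> 1 - k%:R * w <= (1 - w) ^+ k.
Proof.
move=> /andP[w0 w1]; elim: k => [|k ih]; first by rewrite mul0r subr0.
have : 0 <= (1 - w) ^+ k by rewrite exprn_ge0// subr_ge0.
have : 0 <= k%:R :> R by [].
rewrite exprS -natr1; nra.
Qed.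

(** Induction: (1 - w)(1 + (k + 1) w) = 1 + k w - (k + 1) w ^ 2 is at most 1 + k w. *)
Lemma bernoulli_le w k : 0 <= w <= 1 -> (1 - w) ^+ k * (1 + k%:R * w) <= 1.
Proof.
move=> /andP[w0 w1]; elim: k => [|k ih]; first by rewrite mul0r addr0 mulr1.
have : 0 <= (1 - w) ^+ k by rewrite exprn_ge0// subr_ge0.
have : 0 <= k%:R :> R by [].
move: ih; rewrite exprS -natr1 => ih k0 e0; apply: le_trans ih.
rewrite [_ * (1 - w) ^+ k]mulrC -mulrA ler_wpM2l//.
have : 0 <= k%:R * w ^+ 2 by rewrite mulr_ge0 ?sqr_ge0.
have : 0 <= w ^+ 2 by exact: sqr_ge0.
lra.
Qed.

(* The exponent [N * 2 ^ N] makes [(1 - w ^ N) ^ (N * 2 ^ N)] tend to [1] for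
   [w < 1/2], where [N (2 w) ^ N] vanishes, and to [0] for [w >= 1/2], the
   threshold included. *)
Lemma cvg_threshold w : 0 <= w <= 1 ->
  ((1 - w ^+ N) ^+ (N * 2 ^ N)) @[N --> \oo] --> ((w < 2^-1)%R%:R : R).
Proof.
move=> w01; have /andP[w0 w1] := w01.
have wN N : 0 <= w ^+ N <= 1 by rewrite exprn_ge0// exprn_ile1.
have KE N : (N * 2 ^ N)%:R * w ^+ N = N%:R * (2 * w) ^+ N.
  by rewrite natrM natrX exprMn mulrA.
have [w2|w2] := ltP w.
- apply: (@squeeze_cvgr _ _ _ _ (fun N => 1 - N%:R * (2 * w) ^+ N) (fun=> 1)).
  + near=> N; rewrite -KE bernoulli_ge//=.
    have /andP[? ?] := wN N.
    by rewrite exprn_ile1 ?subr_ge0// gerBl.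
  + rewrite -[X in _ --> X]subr0; apply: cvgB; first exact: cvg_cst.
    by apply: cvg_natX; lra.
  + exact: cvg_cst.
- apply: (@squeeze_cvgr _ _ _ _ (fun=> 0) (@harmonic R)).
  + near=> N; have /andP[? ?] := wN N.
    rewrite exprn_ge0 ?subr_ge0//=.
    rewrite -[X in _ <= X]mul1r ler_pdivlMr//.
    apply: le_trans (bernoulli_le (N * 2 ^ N) (wN N)).
    rewrite ler_wpM2l ?exprn_ge0 ?subr_ge0// KE -natr1 addrC lerD2l.
    rewrite ler_peMr// exprn_ege1//; lra.
  + exact: cvg_cst.
  + exact: cvg_harmonic.
Unshelve. all: by end_near. Qed.

(** For a and u in [-1, 1] the difference u - a lies in [-2, 2], so 1/2 + (u - a)/4 lies in [0, 1]
    and is below 1/2 exactly when u < a. *)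
Definition threshold_poly (a : R) N : {poly R} :=
  (1 - (2^-1%:P + 4^-1 *: ('X - a%:P)) ^+ N) ^+ (N * 2 ^ N).

Lemma horner_threshold a N u : (threshold_poly a N).[u] =
  (1 - (2^-1 + 4^-1 * (u - a)) ^+ N) ^+ (N * 2 ^ N).
Proof. by rewrite /threshold_poly !hornerE. Qed.

Let affine_bound (a u : R) : -1 <= a <= 1 -> -1 <= u <= 1 ->
  0 <= 2^-1 + 4^-1 * (u - a) <= 1.
Proof. lra. Qed.

Lemma threshold_bound a N u : -1 <= a <= 1 -> -1 <= u <= 1 ->
  `|(threshold_poly a N).[u]| <= 1.
Proof.
move=> a1 u1; have /andP[h0 h1] := affine_bound a1 u1.
rewrite horner_threshold ger0_norm.
  by rewrite exprn_ile1 ?subr_ge0 ?exprn_ile1// gerBl exprn_ge0.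
by rewrite exprn_ge0 ?subr_ge0 ?exprn_ile1.
Qed.

Lemma cvg_threshold_poly a u : -1 <= a <= 1 -> -1 <= u <= 1 ->
  (threshold_poly a N).[u] @[N --> \oo] --> ((u < a)%R%:R : R).
Proof.
move=> a1 u1; have := cvg_threshold (affine_bound a1 u1).
rewrite (_ : (_ < 2^-1) = (u < a)); last first.
  by rewrite gtrDl pmulr_rlt0 ?subr_lt0// invr_gt0.
by under [X in X @ _ --> _ -> _]eq_fun do rewrite -horner_threshold.
Qed.

End threshold_polynomials.

(** * From moments to the measure of a cap *)

Section cap_law.
Context {R : realType} {p : nat} {mu : probability (p.-tuple R) R}.
Hypothesis mu_inv : rotation_invariant mu.
Hypothesis p2 : (2 <= p)%N.
Local Notation S := (@unit_sphere R p).
Local Notation leb := (@lebesgue_measure R).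
Variable i0 : 'I_p.

(** Both sides obey the same two-step recursion and agree at order 0; at odd orders both vanish. *)
Lemma moment_cos k :
  moment (mu := mu) i0 k * wallis (p - 2) = cos_sin_int k (p - 2) :> R.
Proof.
have pE : p = (p - 2).+2 by rewrite -addn2 subnK.
have [ok|] := boolP (odd k).
  rewrite (moment_odd mu_inv)// mul0r -[k]odd_double_half ok add1n.
  elim: k./2 => [|l ih]; first by rewrite cos_sin_int1.
  have := @cos_sin_int_step R l.*2.+1 (p - 2).
  by rewrite -ih mulr0 => /eqP; rewrite mulf_eq0 pnatr_eq0 addnS/= => /eqP.
move=> ek; rewrite -[k]odd_double_half (negbTE ek) add0n.
elim: k./2 => [|l ih]; first by rewrite (moment0 mu_inv) mul1r wallisE.
have h := @cos_sin_int_step R l.*2 (p - 2).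
have := moment_step mu_inv i0 l.
rewrite {1}pE => h'.
apply: (@mulfI _ (l.*2 + (p - 2).+2)%:R); first by rewrite pnatr_eq0 addnS.
by rewrite doubleS h mulrA h' -ih mulrA.
Qed.

Lemma sphere_poly_integral (h : {poly R}) :
  (\int[mu]_(y in S) h.[tnth y i0]) * wallis (p - 2) =
  \int[leb]_(s in `[0, pi]) (h.[cos s] * sin s ^+ (p - 2)).
Proof.
have mS := @measurable_unit_sphere R p.
transitivity (\sum_(i < size h) h`_i * moment (mu := mu) i0 i * wallis (p - 2)).
  rewrite -mulr_suml; congr (_ * _).
  have mono i : mu.-integrable S (EFin \o fun y => tnth y i0 ^+ i).
    apply: eq_integrable (sphere_integrable_monomial mu_inv i0 i0 i 0) => //.
    by move=> y _ /=; rewrite expr0 mulr1.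
  under eq_bigr => i _ do rewrite -RintegralZl//.
  rewrite -Rintegral_sum//; last by move=> i; exact: integrable_scale.
  by apply: eq_Rintegral => y _; rewrite horner_coef.
under eq_bigr => i _ do rewrite -mulrA moment_cos -RintegralZl ?cos_sin_integrable//.
rewrite -Rintegral_sum//; last first.
  by move=> i; apply: integrable_scale => //; exact: cos_sin_integrable.
apply: eq_Rintegral => s _; rewrite horner_coef mulr_suml.
by apply: eq_bigr => i _; rewrite mulrA.
Qed.

Lemma Rintegral_dominated d (T : measurableType d)
    (nu : {measure set T -> \bar R}) (D : set T)
    (f : nat -> T -> R) (f' g : T -> R) : measurable D ->
  (forall n, measurable_fun D (f n)) -> measurable_fun D f' ->
  nu.-integrable D (EFin \o g) ->
  (forall x, D x -> f n x @[n --> \oo] --> f' x) ->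
  (forall n x, D x -> `|f n x| <= g x) ->
  \int[nu]_(x in D) f n x @[n --> \oo] --> \int[nu]_(x in D) f' x.
Proof.
move=> mD mf mf' ig ff' fg.
have [] := @dominated_convergence _ _ _ nu D mD
    (fun n x => (f n x)%:E) (fun x => (f' x)%:E) (EFin \o g).
- by move=> n; exact/measurable_EFinP.
- exact/measurable_EFinP.
- apply: aeW => x Dx; apply: cvg_EFin; first exact: nearW.
  exact: ff'.
- exact: ig.
- by apply: aeW => x Dx n; rewrite /= lee_fin; exact: fg.
move=> if' _ h.
apply: fine_cvg; rewrite fineK//; exact: integrable_fin_num.
Qed.

Lemma sphere_coord_cap theta : 0 <= theta <= pi ->
  fine (mu [set y | cos theta <= tnth y i0]) * wallis (p - 2) =
  \int[leb]_(s in `[0, theta]) (sin s ^+ (p - 2)).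
Proof.
move=> th; have /andP[th0 thpi] := th; set a := cos theta.
have mS := @measurable_unit_sphere R p.
have mtn : measurable_fun setT (fun y : p.-tuple R => tnth y i0).
  exact: measurable_tnth.
have a1 : -1 <= a <= 1 by rewrite cos_geN1 cos_le1.
have mI : measurable (`[0, pi]%classic : set R) by exact: measurable_itv.
pose h N : {poly R} := 1 - threshold_poly a N.
have hE N u : (h N).[u] = 1 - (threshold_poly a N).[u] by rewrite /h !hornerE.
have h2 N u : -1 <= u <= 1 -> `|(h N).[u]| <= 2.
  move=> u1; rewrite hE (le_trans (ler_normB _ _))// normr1.
  by rewrite -[leRHS]/(1 + 1) lerD2l threshold_bound.
have hcvg u : -1 <= u <= 1 -> (h N).[u] @[N --> \oo] --> ((a <= u)%R%:R : R).
  move=> u1; under eq_fun do rewrite hE.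
  rewrite (_ : (a <= u)%R%:R = 1 - (u < a)%R%:R); last first.
    by case: leP => _; rewrite ?subr0 ?subrr.
  by apply: cvgB; [exact: cvg_cst|exact: cvg_threshold_poly].
have mh N : measurable_fun setT (fun u => (h N).[u]).
  by apply: continuous_measurable_fun; exact: continuous_horner.
have mle : measurable_fun setT (fun u => (a <= u)%R%:R : R).
  rewrite (_ : (fun u => _) = \1_(`[a, +oo[%classic)); last first.
    by apply/funext => u; rewrite indicE mem_setE in_itv/= andbT.
  exact: measurable_indic.
have mcos : measurable_fun setT (@cos R).
  by apply: continuous_measurable_fun; exact: continuous_cos.
have msin : measurable_fun setT (fun s : R => sin s ^+ (p - 2)).
  by apply: continuous_measurable_fun; exact: continuous_sinX.
have yb y : S y -> -1 <= tnth y i0 <= 1.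
  by move=> Sy; rewrite -ler_norml sphere_coord_bound.
have cb (s : R) : -1 <= cos s <= 1 by rewrite cos_geN1 cos_le1.
have cvg1 : (\int[mu]_(y in S) (h N).[tnth y i0]) * wallis (p - 2) @[N --> \oo]
    --> (\int[mu]_(y in S) (a <= tnth y i0)%R%:R) * wallis (p - 2).
  apply: cvgM; last exact: cvg_cst.
  apply: (@Rintegral_dominated _ _ mu S _ _ (fun=> 2)) => //.
  - by move=> N; apply: measurable_funTS; exact: (measurableT_comp (mh N) mtn).
  - by apply: measurable_funTS; exact: (measurableT_comp mle mtn).
  - exact: finite_measure_integrable_cst.
  - by move=> y Sy; apply: hcvg; exact: yb.
  - by move=> N y Sy; apply: h2; exact: yb.
have cvg2 : \int[leb]_(s in `[0, pi]) ((h N).[cos s] * sin s ^+ (p - 2)) @[N --> \oo]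
    --> \int[leb]_(s in `[0, pi]) ((a <= cos s)%R%:R * sin s ^+ (p - 2)).
  apply: (@Rintegral_dominated _ _ leb _ _ _
    (fun s => 2 * `|sin s ^+ (p - 2)|)) => //.
  - move=> N; apply: measurable_funTS; apply: measurable_funM => //.
    exact: (measurableT_comp (mh N) mcos).
  - apply: measurable_funTS; apply: measurable_funM => //.
    exact: (measurableT_comp mle mcos).
  - by apply: integrable_scale => //; apply/integrable_norm/sinX_integrable.
  - by move=> s _; apply: cvgM; [exact: hcvg|exact: cvg_cst].
  - by move=> N s _; rewrite normrM ler_wpM2r// h2.
have <- : \int[mu]_(y in S) (a <= tnth y i0)%R%:R =
    fine (mu [set y | a <= tnth y i0]).
  rewrite /Rintegral sphere_integral//; last first.
    by apply/measurable_EFinP; exact: (measurableT_comp mle mtn).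
  have mA : measurable [set y : p.-tuple R | a <= tnth y i0].
    have := mtn measurableT _ (measurable_itv `[a, +oo[).
    rewrite setTI; congr measurable; apply/seteqP.
    by split => y /=; rewrite in_itv/= andbT.
  rewrite -[in RHS](setIT [set y | _]) -integral_indic//; congr fine.
  by apply: eq_integral => y _; rewrite indicE mem_setE.
(* By [sphere_poly_integral] the two convergent sequences coincide, hence so do their limits. What
   remains is that cosine decreases on [0, pi]. *)
transitivity (\int[leb]_(s in `[0, pi]) ((a <= cos s)%R%:R * sin s ^+ (p - 2))).
  rewrite -(eq_cvg _ _ (fun N => sphere_poly_integral (h N))) in cvg2.
  exact: (cvg_unique _ cvg1 cvg2).
transitivity (\int[leb]_(s in `[0, pi] `&` `[0, theta]) (sin s ^+ (p - 2))).
  rewrite Rintegral_mkcondr; apply: eq_Rintegral => s.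
  rewrite inE/= in_itv/= => /andP[s0 spi].
  rewrite patchE mem_setE in_itv/= s0/= leNgt.
  have -> : (cos s < a) = (theta < s) by rewrite ltr_cos ?in_itv/= ?s0 ?th.
  by case: ltP => _; rewrite ?mul0r ?mul1r.
congr Rintegral; apply/seteqP; split => s /=; rewrite !in_itv/=; first by case.
move=> /andP[s0 st]; split; first by rewrite s0 (le_trans st).
by rewrite s0.
Qed.

Lemma sphere_cap z theta : S z -> 0 <= theta <= pi ->
  fine (mu [set y | cos theta <= dotp z y]) =
  (\int[leb]_(s in `[0, theta]) (sin s ^+ (p - 2))) / wallis (p - 2).
Proof.
move=> Sz th; rewrite -(sphere_coord_cap th) mulfK ?gt_eqF ?wallis_gt0//.
congr fine.
pose e : p.-tuple R := [tuple (k == i0)%:R | k < p].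
have dotpe y : dotp e y = tnth y i0.
  rewrite /dotp (bigD1 i0)//= tnth_mktuple eqxx mul1r big1 ?addr0// => k ki.
  by rewrite tnth_mktuple (negbTE ki) mul0r.
have Se : S e by apply/unit_sphereP; rewrite dotpe tnth_mktuple eqxx.
have := dotp_law mu_inv Sz Se (measurable_itv `[cos theta, +oo[).
rewrite (_ : dotp z @^-1` _ = [set y | cos theta <= dotp z y]); last first.
  by apply/seteqP; split => y /=; rewrite in_itv/= andbT.
move=> ->; congr (mu _); apply/seteqP.
by split => y /=; rewrite in_itv/= andbT dotpe.
Qed.

End cap_law.

(** * Asymptotics of small caps *)

Section sine_integral.
Context {R : realType}.
Local Notation leb := (@lebesgue_measure R).
Implicit Types (q : nat) (th : R).

Definition sin_int q th : R := \int[leb]_(s in `[0, th]) (sin s ^+ q).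

Let int_cos_sinX q th : 0 < th ->
  q.+1%:R * \int[leb]_(s in `[0, th]) (cos s ^+ 1 * sin s ^+ q) = sin th ^+ q.+1.
Proof.
move=> th0; rewrite -RintegralZl//; last first.
  by apply: continuous_itv_integrable => x _; exact: continuous_cosXsinX.
under eq_Rintegral do rewrite expr1.
rewrite (Rintegral_derive th0 (fun x _ => is_derive_sinX q x)).
  by rewrite sin0 expr0n/= subr0.
by move=> x _; exact: (continuous_scale (@continuous_cosXsinX _ 1 q x)).
Qed.

Let int_cos2_sinX q th : 0 < th ->
  q.+2%:R * \int[leb]_(s in `[0, th]) (cos s ^+ 2 * sin s ^+ q) =
  cos th * sin th ^+ q.+1 + sin_int q th.
Proof.
move=> th0.
have := Rintegral_derive th0 (fun x _ => is_derive_cosXsinX 0 q x).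
have i k : leb.-integrable `[0, th] (EFin \o fun s => cos s ^+ k * sin s ^+ q).
  by apply: continuous_itv_integrable => x _; exact: continuous_cosXsinX.
rewrite RintegralB//; last 2 first.
- exact/integrable_scale/i.
- exact/integrable_scale/i.
rewrite !RintegralZl ?i//; last exact: sinX_integrable.
rewrite sin0 expr0n/= mulr0 subr0 expr1 !mul1r add0n => h.
rewrite -h; first by rewrite -/(sin_int q th) subrK.
move=> x _; exact: (cvgB (continuous_scale (@continuous_cosXsinX _ 2 q x))
             (continuous_scale (@continuous_cosXsinX _ 0 q x))).
Qed.

(** On [0, th] cosine is at least cos th, and cos s sin s ^ q has an explicit primitive. *)
Lemma sin_int_upper q th : 0 < th < pi / 2 ->
  sin_int q th * (q.+1%:R * cos th) <= sin th ^+ q.+1.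
Proof.
move=> /andP[th0 th2]; have pi0 := pi_gt0 R.
rewrite mulrC -(int_cos_sinX q th0) -mulrA ler_wpM2l//.
rewrite -RintegralZl//; last exact: sinX_integrable.
apply: le_Rintegral => //.
- by apply: integrable_scale => //; exact: sinX_integrable.
- by apply: continuous_itv_integrable => x _; exact: continuous_cosXsinX.
move=> s /=; rewrite in_itv/= => /andP[s0 st].
rewrite expr1 ler_wpM2r ?exprn_ge0 ?sin_ge0_pi ?s0//=; first by lra.
by rewrite leNgt ltr_cos ?in_itv/= -?leNgt//; apply/andP; split; lra.
Qed.

(* The convexity bound [1 / c >= 2 / c0 - c / c0 ^ 2] with [c = cos s] and
   [c0 = cos th] makes both sides explicitly integrable against [sin s ^ q]. *)
Lemma sin_int_lower q th : 0 < th < pi / 2 ->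
  sin th ^+ q.+1 <=
  sin_int q th * (q.+1%:R * cos th) * (1 + (q.+1%:R * cos th ^+ 2)^-1).
Proof.
move=> /andP[th0 th2]; have pi0 := pi_gt0 R.
have c0 : 0 < cos th by rewrite cos_gt0_pihalf//; apply/andP; split; lra.
have s0 : 0 <= sin th by rewrite sin_ge0_pi//; apply/andP; split; lra.
set c := cos th in c0 *; set I := sin_int q th.
have i k : leb.-integrable `[0, th] (EFin \o fun s => cos s ^+ k * sin s ^+ q).
  by apply: continuous_itv_integrable => x _; exact: continuous_cosXsinX.
set A := \int[leb]_(s in `[0, th]) (cos s ^+ 1 * sin s ^+ q).
set K := \int[leb]_(s in `[0, th]) (cos s ^+ 2 * sin s ^+ q).
have I0 : 0 <= I.
  apply: Rintegral_ge0 => s /=; rewrite in_itv/= => /andP[s0' st].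
  by rewrite exprn_ge0// sin_ge0_pi// s0'/=; lra.
(* The convexity bound cleared of denominators: (c - cos s) ^ 2 >= 0, integrated against sin s ^
   q. *)
have IAK : 2 * c * A - K <= c ^+ 2 * I.
  rewrite /I /sin_int -!RintegralZl//; last exact: sinX_integrable.
  rewrite -RintegralB//; last exact: integrable_scale.
  apply: le_Rintegral => //.
  - have := integrableB _ (integrable_scale (2 * c) _ (i 1%N)) (i 2%N).
    by apply.
  - by apply: integrable_scale => //; exact: sinX_integrable.
  move=> s /=; rewrite in_itv/= => /andP[s0' st].
  rewrite mulrA -mulrBl ler_wpM2r ?exprn_ge0 ?sin_ge0_pi ?s0'//=; first by lra.
  by rewrite expr1 -subr_ge0 (_ : _ - _ = (c - cos s) ^+ 2) ?sqr_ge0//; ring.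
have hA := int_cos_sinX q th0; rewrite -/A in hA.
have hK := int_cos2_sinX q th0; rewrite -/K -/c -/I in hK.
set y := sin th ^+ q.+1 in hA hK *.
have y0 : 0 <= y by exact: exprn_ge0.
have q1 : 0 < q.+1%:R :> R by rewrite ltr0n.
set r : R := q.+1%:R in q1 hA *.
have q2 : q.+2%:R = r + 1 :> R by rewrite /r -natr1.
rewrite q2 in hK.
have -> : I * (r * c) * (1 + (r * c ^+ 2)^-1) = r * c * I + I / c.
  by field; rewrite !gt_eqF.
have AE : A = y / r by rewrite -hA mulrC mulKf// gt_eqF.
have KE : K = (c * y + I) / (r + 1).
  by rewrite -hK mulrC mulKf// gt_eqF// addr_gt0.
have h1 : 2 * c * y * (r + 1) - r * (c * y + I) <= c ^+ 2 * I * r * (r + 1).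
  have : (2 * c * A - K) * (r * (r + 1)) <= c ^+ 2 * I * (r * (r + 1)).
    by rewrite ler_wpM2r// mulr_ge0 ?addr_ge0 ?ltW.
  rewrite AE KE (_ : (_ - _) * _ = 2 * c * y * (r + 1) - r * (c * y + I)) ?mulrA//.
  by field; rewrite !gt_eqF// addr_gt0.
have h2 : c * y * (r + 2) <= I * r * (c ^+ 2 * (r + 1) + 1) by lra.
(* Both sides are weakened, r + 2 to r + 1 on the left and r to r + 1 in the last term on the right,
   so that r + 1 cancels. *)
have h3 : c * y * (r + 1) <= I * (r + 1) * (r * c ^+ 2 + 1).
  have cy0 : 0 <= c * y by rewrite mulr_ge0// ltW.
  move: h2 cy0 I0; lra.
have {h3} : c * y <= I * (r * c ^+ 2 + 1).
  rewrite -(@ler_pM2r _ (r + 1)) ?addr_gt0// (le_trans h3)// le_eqVlt.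
  by apply/orP; left; apply/eqP; ring.
rewrite -ler_pdivlMl// => /le_trans; apply; rewrite le_eqVlt; apply/orP; left.
by apply/eqP; field; rewrite gt_eqF.
Qed.

End sine_integral.

Section trigonometric_bounds.
Context {R : realType}.
Implicit Types (x y : R).

Lemma abs_sin_le x : `|sin x| <= `|x|.
Proof.
wlog x0 : x / 0 <= x.
  move=> h; have [/h//|x0] := leP 0 x.
  by have := h (- x); rewrite sinN !normrN; apply; lra.
have [c _] := @MVT_segment _ sin cos 0 x x0 (fun x _ => is_derive_sin x)
  (continuous_subspaceT (@continuous_sin R)).
rewrite sin0 !subr0 => ->.
by rewrite normrM ler_piMl// cos_max.
Qed.

Lemma abs_cosB1_le x : `|cos x - 1| <= x ^+ 2 / 2.
Proof.
have -> : cos x - 1 = - (2 * sin (x / 2) ^+ 2).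
  rewrite {1}(_ : x = (x / 2) *+ 2); last by rewrite mulr2n; lra.
  by rewrite cos_mulr2n cos2sin2 mulr2n; ring.
have := abs_sin_le (x / 2).
rewrite -(@ler_pXn2r _ 2) ?nnegrE// !real_normK ?num_real// => h.
rewrite normrN ger0_norm; last by have := sqr_ge0 (sin (x / 2)); lra.
by move: h; rewrite exprMn; lra.
Qed.

Lemma abs_sinBid_le x : `|sin x - x| <= x ^+ 2 / 2 * `|x|.
Proof.
wlog x0 : x / 0 <= x.
  move=> h; have [/h//|x0] := leP 0 x.
  have := h (- x); rewrite (_ : sin (- x) - - x = - (sin x - x)).
    by rewrite !normrN sqrrN; apply; lra.
  by rewrite sinN; ring.
have d y : y \in `]0, x[ -> is_derive y 1 (@sin R \- id) (cos y - 1).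
  by move=> _; exact: is_deriveB.
have cd : {within `[0, x], continuous (@sin R \- id)}.
  apply: continuous_subspaceT => y.
  by apply: cvgB; [exact: continuous_sin|exact: cvg_id].
have [c] := MVT_segment x0 d cd.
rewrite in_itv/= sin0 !subr0 => /andP[c0 cx] ->.
rewrite normrM ler_wpM2r// (le_trans (abs_cosB1_le c))//.
by rewrite ler_wpM2r// ler_sqr.
Qed.

(** Applying ln (1 + z) <= z to the inverse of 1 + y gives ln (1 + y) >= y / (1 + y), which exceeds
    y - 2 y ^ 2 by y ^ 2 (1 + 2 y) / (1 + y). *)
Lemma ln1D_ge y : - 2^-1 <= y -> y - 2 * y ^+ 2 <= ln (1 + y).
Proof.
move=> y2; have y1 : 0 < 1 + y by lra.
rewrite -[ln _]opprK -lnV// lerNr.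
have -> : (1 + y)^-1 = 1 + - (y / (1 + y)) by field; rewrite gt_eqF.
apply: (le_trans (le_ln1Dx _)).
  rewrite -subr_gt0 (_ : _ - _ = (1 + y)^-1) ?invr_gt0//.
  by field; rewrite gt_eqF.
rewrite lerN2 ler_pdivlMr//.
have : 0 <= y ^+ 2 * (1 + 2 * y) by rewrite mulr_ge0 ?sqr_ge0//; lra.
lra.
Qed.

End trigonometric_bounds.

(** * Sine and cosine at a small displacement of a base angle *)

Section perturbed_angle.
Context {R : realType} (m : nat) (b lam : R).
Hypothesis m0 : (0 < m)%N.
Hypothesis b0 : 0 < b < pi / 2.
Let c := cos b.
Let s := sin b.
Let v := m%:R * c ^+ 2.
(** For b = arcsin t_n, m = p - 1 and lam = x + ln v, the angle b + [del] is the threshold. [kap]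
    measures all quadratic remainders: [mdel2] and [mr2] bound m del ^ 2 and m r ^ 2 by kap / 4. *)
Let kap := lam ^+ 2 / v.
Let del := s / (2 * m%:R * c) * lam.
Hypothesis v1 : 1 <= v.
Hypothesis kap1 : kap <= 4^-1.
Hypothesis eta1 : 2 * kap + v^-1 < 1.
Let S := sin (b + del) / s.
Let C := cos (b + del) / c.

Let mr : 1 <= m%:R :> R.
Proof. by rewrite ler1n. Qed.
Let c0 : 0 < c.
Proof. by apply: cos_gt0_pihalf; have /andP[h1 h2] := b0; apply/andP; split; lra. Qed.
Let s0 : 0 < s.
Proof. exact: sin_gt0_pihalf. Qed.
Let v0 : 0 < v. Proof. exact: lt_le_trans ltr01 v1. Qed.
Let cs : c ^+ 2 + s ^+ 2 = 1. Proof. exact: cos2Dsin2. Qed.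
Let kap0 : 0 <= kap. Proof. by rewrite mulr_ge0 ?sqr_ge0// invr_ge0 ltW. Qed.
Let kap40 : 0 <= kap / 4. Proof. by rewrite divr_ge0. Qed.
Let lam2 : lam ^+ 2 = kap * v.
Proof. by rewrite /kap mulfVK// gt_eqF. Qed.
Let mn0 : m%:R != 0 :> R. Proof. by rewrite gt_eqF// (lt_le_trans _ mr). Qed.
Let cn0 : c != 0. Proof. by rewrite gt_eqF. Qed.
Let sn0 : s != 0. Proof. by rewrite gt_eqF. Qed.

Let mdel2 : m%:R * del ^+ 2 <= kap / 4.
Proof.
have -> : m%:R * del ^+ 2 = s ^+ 2 * (kap / 4).
  by rewrite /del exprMn lam2 /v; field; apply/andP; split.
rewrite ler_piMl ?kap40//; have := sqr_ge0 c; move: cs; lra.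
Qed.

Let del2 : del ^+ 2 <= kap / 4.
Proof. by apply: le_trans mdel2; rewrite ler_peMl ?sqr_ge0. Qed.

(** The first-order relative variation cot b * del of the sine; m r = lam / 2 is the exponent wanted
    for (sin (b + del) / sin b) ^ m. *)
Let r := lam / (2 * m%:R).

Let mr2 : m%:R * r ^+ 2 <= kap / 4.
Proof.
have -> : m%:R * r ^+ 2 = c ^+ 2 * (kap / 4).
  by rewrite /r exprMn lam2 /v; field.
rewrite ler_piMl ?kap40//; have := sqr_ge0 s; move: cs; lra.
Qed.

Let r2 : r ^+ 2 <= kap / 4.
Proof. by apply: le_trans mr2; rewrite ler_peMl ?sqr_ge0. Qed.

Let r1 : `|r| <= 4^-1.
Proof.
rewrite -(@ler_pXn2r _ 2) ?nnegrE ?invr_ge0// real_normK ?num_real//.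
by apply: (le_trans r2); rewrite [leRHS]expr2 ler_wpM2r.
Qed.

Let SE : S = cos del + c / s * sin del.
Proof. by rewrite /S sinD -/c -/s; field. Qed.

Let CE : C = cos del - s / c * sin del.
Proof. by rewrite /C cosD -/c -/s; field. Qed.

(** The ratio is cos del - tan b sin del. The second term is at most |lam| / (2 v), linear in lam,
    whence the extra v ^ -1: |lam| <= lam ^ 2 + 1. *)
Lemma perturbed_cos : `|C - 1| <= 2 * kap + v^-1.
Proof.
have h1 : `|s / c * sin del| <= (kap + v^-1) / 2.
  apply: (@le_trans _ _ (s / c * `|del|)).
    by rewrite normrM gtr0_norm ?divr_gt0// ler_wpM2l ?abs_sin_le// divr_ge0 ?ltW.
  have -> : s / c * `|del| = s ^+ 2 * (`|lam| / v / 2).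
    rewrite /del normrM gtr0_norm; last first.
      by rewrite divr_gt0// !mulr_gt0// (lt_le_trans _ mr).
    by rewrite /v; field; apply/andP; split.
  apply: (@le_trans _ _ (`|lam| / v / 2)).
    rewrite ler_piMl//; first by rewrite !mulr_ge0// invr_ge0 ltW.
    by have := sqr_ge0 c; move: cs; lra.
  rewrite ler_pM2r ?invr_gt0// /kap -[X in _ + X]mul1r -mulrDl ler_pM2r ?invr_gt0//.
  rewrite -(real_normK (num_real lam)).
  have := sqr_ge0 (`|lam| - 2^-1); lra.
rewrite CE addrAC (le_trans (ler_normB _ _))//.
have := abs_cosB1_le del; have : 0 <= v^-1 by rewrite invr_ge0 ltW.
by move: h1 del2 kap0; lra.
Qed.

Let S1 : `|S - 1 - r| <= del ^+ 2.
Proof.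
have -> : S - 1 - r = (cos del - 1) + c / s * (sin del - del).
  by rewrite SE /del /r; field; apply/and3P; split.
apply: (le_trans (ler_normD _ _)).
have h : `|c / s * (sin del - del)| <= del ^+ 2 / 2 * `|r|.
  rewrite normrM gtr0_norm ?divr_gt0//.
  apply: (@le_trans _ _ (c / s * (del ^+ 2 / 2 * `|del|))).
    by rewrite ler_wpM2l ?abs_sinBid_le// divr_ge0 ?ltW.
  rewrite mulrCA ler_wpM2l ?divr_ge0 ?sqr_ge0//.
  have -> : r = c / s * del by rewrite /del /r; field; apply/and3P; split.
  by rewrite (normrM (c / s)) (@gtr0_norm _ (c / s)) ?divr_gt0// lexx.
have h2 : del ^+ 2 / 2 * `|r| <= del ^+ 2 / 2 * 4^-1.
  by rewrite ler_wpM2l ?divr_ge0 ?sqr_ge0.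
have := abs_cosB1_le del; have := sqr_ge0 del; move: h h2; lra.
Qed.

Let S2 : `|S - 1| <= 2^-1.
Proof.
have -> : S - 1 = (S - 1 - r) + r by ring.
apply: (le_trans (ler_normD _ _)); move: S1 r1 del2 kap1; lra.
Qed.

Lemma perturbed_sin_gt0 : 0 < S.
Proof. by move: S2; rewrite ler_norml => /andP[]; lra. Qed.

(** With e = S - 1, the logarithm lies between e - 2 e ^ 2 and e, and e = r up to del ^ 2 by [S1].
    After multiplication by m the main term is m r = lam / 2 and the remainders m del ^ 2 and m e ^
    2 are controlled by [kap]. *)
Lemma perturbed_sin : `|m%:R * ln S - lam / 2| <= 3 * kap.
Proof.
have -> : lam / 2 = m%:R * r by rewrite /r; field.
have [e eE] : {e | e = S - 1} by exists (S - 1).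
have -> : S = 1 + e by rewrite eE; ring.
have := S1; have := S2; rewrite -eE => S2' S1'.
have := S2'; rewrite ler_norml => /andP[e1 e2].
have lnu := @le_ln1Dx R e ltac:(lra).
have lnl := ln1D_ge e1.
have := S1'; rewrite ler_norml => /andP[d1 d2].
have dd := sqr_ge0 del.
have m1 : 0 <= m%:R :> R by [].
have e22 : e ^+ 2 <= 2 * r ^+ 2 + 2 * del ^+ 2 * 4^-1.
  have h : (e - r) ^+ 2 <= del ^+ 2 * 4^-1.
    have : `|e - r| * `|e - r| <= del ^+ 2 * 4^-1.
      by rewrite ler_pM//; move: del2 kap1 S1'; lra.
    by rewrite -normrM -expr2 ger0_norm ?sqr_ge0.
  by have := sqr_ge0 (e - 2 * r); lra.
have me2 := ler_wpM2l m1 e22.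
have md1 := ler_wpM2l m1 d1.
have md2 := ler_wpM2l m1 d2.
have mu := ler_wpM2l m1 lnu.
have ml := ler_wpM2l m1 lnl.
rewrite ler_norml; apply/andP; split; move: me2 md1 md2 mu ml mdel2 mr2 kap0; lra.
Qed.

(** Sine and cosine are still positive at b + del, and |del| <= 1/4 prevents the angle from reaching
    another quadrant with these signs. *)
Lemma perturbed_angle_itv : 0 < b + del < pi / 2.
Proof.
have /andP[b1 b2] := b0; have pi2 := pihalf_ge1 R.
have d4 : `|del| <= 4^-1.
  rewrite -(@ler_pXn2r _ 2) ?nnegrE ?invr_ge0// real_normK ?num_real//.
  by apply: (le_trans del2); rewrite [leRHS]expr2 ler_wpM2r.
move: d4; rewrite ler_norml => /andP[d1 d2].
have sp : 0 < sin (b + del).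
  by have := mulr_gt0 perturbed_sin_gt0 s0; rewrite /S divfK.
have cp : 0 < cos (b + del).
  have C0 : 0 < C.
    by move: perturbed_cos eta1; rewrite ler_norml => /andP[]; lra.
  by have := mulr_gt0 C0 c0; rewrite /C divfK.
apply/andP; split.
  rewrite ltNge; apply/negP => h; move: sp.
  rewrite -[b + del]opprK sinN oppr_gt0 ltNge sin_ge0_pi//.
  by apply/andP; split; lra.
rewrite ltNge; apply/negP => h; move: cp; rewrite ltNge -(cos_pihalf R).
by rewrite leNgt ltr_cos ?in_itv/= -?leNgt ?h//; apply/andP; split; lra.
Qed.

End perturbed_angle.

Section limits.
Context {R : realType}.

Lemma cvg_continuous_comp {T : Type} {F : set_system T} {FF : Filter F}
    (h : R -> R) (f : T -> R) (a : R) : continuous h ->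
  f x @[x --> F] --> a -> h (f x) @[x --> F] --> h a.
Proof. by move=> ch fa; exact: (@continuous_cvg _ _ _ F FF f h a (ch a) fa). Qed.

(** By monotonicity W_(k+1) ^ 2 lies between W_(k+1) W_(k+2) and W_k W_(k+1), both given by
    [wallis_mul]; the index is shifted so that a predecessor exists. *)
Lemma cvg_sqrt_wallis :
  Num.sqrt k.+1%:R * wallis k @[k --> \oo] --> Num.sqrt (2 * pi : R).
Proof.
have h k : Num.sqrt k.+1%:R * wallis k = Num.sqrt (k.+1%:R * wallis k ^+ 2) :> R.
  by rewrite sqrtrM// sqrtr_sqr ger0_norm// ltW// wallis_gt0.
rewrite (eq_cvg _ _ h).
apply: cvg_continuous_comp; first exact: sqrt_continuous.
have pi0 := pi_gt0 R.
rewrite -cvg_shiftS /=.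
apply: (@squeeze_cvgr _ _ _ _ (fun=> 2 * pi)
    (fun k => 2 * pi * (1 + k.+1%:R^-1))).
- near=> k.
  have w1 := wallis_gt0 (R := R) k.+1; have w := wallis_le (R := R) k.
  have w' := wallis_le (R := R) k.+1.
  have e1 := wallis_mul (R := R) k.+1; have e0 := wallis_mul (R := R) k.
  have k0 : 0 < k.+1%:R :> R by [].
  apply/andP; split.
    rewrite -e1 mulrC ler_wpM2l// expr2 ler_wpM2l//; exact: ltW.
  rewrite -e0 -[k.+2%:R]natr1.
  rewrite (_ : _ * (1 + _) = wallis k * wallis k.+1 * (k.+1%:R + 1)).
    by rewrite mulrC ler_wpM2r ?addr_ge0// expr2 ler_wpM2r// ltW.
  by field; rewrite gt_eqF.
- exact: cvg_cst.
- rewrite [X in _ --> X](_ : _ = 2 * pi * (1 + 0)); last by rewrite addr0 mulr1.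
  by apply: cvgM; [exact: cvg_cst|apply: cvgD; [exact: cvg_cst|exact: cvg_harmonic]].
Unshelve. all: by end_near. Qed.

(** Write u = z ^ 4 and use ln z < z: then ln u = 4 ln z is at most 4 times the fourth root. *)
Lemma ln_le_root4 (u : R) : 1 <= u -> ln u ^+ 2 <= 16 * Num.sqrt u.
Proof.
move=> u1; have u0 : 0 < u by exact: lt_le_trans u1.
set w := Num.sqrt u; set z := Num.sqrt w.
have w0 : 0 < w by rewrite sqrtr_gt0.
have z0 : 0 < z by rewrite sqrtr_gt0.
have uE : u = z ^+ 4.
  by rewrite (exprM z 2 2) sqr_sqrtr ?sqr_sqrtr// ltW.
have l0 : 0 <= ln z.
  apply: ln_ge0; by rewrite -(@ler_pXn2r _ 4) ?nnegrE ?(ltW z0)// expr1n -uE.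
have wE : w = z ^+ 2 by rewrite sqr_sqrtr// ltW.
rewrite wE uE lnXn// -[ln z *+ 4]mulr_natl exprMn.
rewrite (_ : 4%:R ^+ 2 = 16 :> R); last by rewrite -natrX.
by rewrite ler_wpM2l// ler_sqr ?nnegrE ?(ltW z0)// ltW// ln_sublinear.
Qed.

Lemma cvg_sqr_lnV (x : R) (v : R ^nat) : v n @[n --> \oo] --> +oo ->
  (x + ln (v n)) ^+ 2 / v n @[n --> \oo] --> 0.
Proof.
move=> voo.
have vV : (v n)^-1 @[n --> \oo] --> 0.
  by apply/gtr0_cvgV0 => //; exact: (cvgry_gt voo).
have sV : Num.sqrt (v n)^-1 @[n --> \oo] --> 0.
  rewrite -[X in _ --> X](sqrtr0 R).
  by apply: cvg_continuous_comp => //; exact: sqrt_continuous.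
apply: (@squeeze_cvgr _ _ _ _ (fun=> 0)
    (fun n => 2 * x ^+ 2 * (v n)^-1 + 32 * Num.sqrt (v n)^-1)).
- near=> n; have v1 : 1 <= v n by near: n; exact: (cvgry_ge voo).
  have v0 : 0 < v n by exact: lt_le_trans v1.
  rewrite mulr_ge0 ?sqr_ge0 ?invr_ge0 ?(ltW v0)//=.
  have -> : 32 * Num.sqrt (v n)^-1 = 2 * (16 * Num.sqrt (v n)) / v n.
    have w0 : 0 < Num.sqrt (v n) by rewrite sqrtr_gt0.
    have vE := sqr_sqrtr (ltW v0).
    rewrite sqrtrV ?(ltW v0)//; set w := Num.sqrt (v n) in w0 vE *.
    by rewrite -vE; field; rewrite gt_eqF.
  rewrite -mulrDl ler_wpM2r ?invr_ge0 ?(ltW v0)//.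
  have := ln_le_root4 v1; have := sqr_ge0 (x - ln (v n)); lra.
- exact: cvg_cst.
- rewrite [X in _ --> X](_ : _ = 2 * x ^+ 2 * 0 + 32 * 0); last first.
    by rewrite !mulr0 addr0.
  by apply: cvgD; apply: cvgM => //; exact: cvg_cst.
Unshelve. all: by end_near. Qed.

End limits.

(** * The cap at the threshold angle *)

Section angular_threshold.
Context {R : realType} (p : nat -> nat).
Hypothesis p_ge2 : forall n, (2 <= n)%N -> (2 <= p n)%N.
Hypothesis p_oo : p n @[n --> \oo] --> \oo.
Local Notation t n := (t_ R n (p n)).
Local Notation m n := ((p n)%:R - 1 : R).

Definition vfactor n : R := m n * (1 - t n ^+ 2).

Definition threshold n x : R :=
  asin (t n) + alpha_ R n (p n) * (x + ln (vfactor n)).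

Let pE n : (2 <= n)%N -> p n = (p n - 2).+2.
Proof. by move=> n2; rewrite -addn2 subnK// p_ge2. Qed.

Let mE n : (2 <= n)%N -> m n = (p n - 2).+1%:R.
Proof. by move=> n2; rewrite {1}pE// -natr1 addrK. Qed.

Let m_gt0 n : (2 <= n)%N -> 0 < m n.
Proof. by move=> n2; rewrite mE. Qed.

Let ln_gt0n n : (2 <= n)%N -> 0 < ln n%:R :> R.
Proof. by move=> n2; rewrite ln_gt0// ltr1n. Qed.

Let t_itv n : (2 <= n)%N -> 0 < t n < 1.
Proof.
move=> n2; rewrite expR_gt0/= expR_lt1 oppr_lt0 divr_gt0 ?m_gt0//.
by rewrite mulr_gt0// ln_gt0n.
Qed.

Lemma alpha_gt0 n : (2 <= n)%N -> 0 < alpha_ R n (p n).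
Proof.
move=> n2; have /andP[t0 t1] := t_itv n2.
rewrite /alpha_ divr_gt0// !mulr_gt0 ?m_gt0// sqrtr_gt0 subr_gt0.
by rewrite expr_lt1// ltW.
Qed.

(** The calibration behind t_n: its power p - 1 compensates the n ^ 2 of the number of pairs
    exactly. *)
Let tX n : (2 <= n)%N -> n%:R ^+ 2 * t n ^+ (p n - 2).+1 = 1.
Proof.
move=> n2; have n0 : 0 < n%:R :> R by rewrite ltr0n; lia.
rewrite /t_ -expRM_natl -mE// mulrN [m n * _]mulrC divfK ?gt_eqF ?m_gt0//.
rewrite expRN mulr_natl -lnXn// lnK ?posrE ?exprn_gt0// divff//.
by rewrite gt_eqF ?exprn_gt0.
Qed.

Lemma cvg_vfactor : vfactor n @[n --> \oo] --> +oo.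
Proof.
have lnoo : ln n%:R @[n --> \oo] --> (+oo : set_system R).
  apply/cvgryPge => A; near=> n.
  have n0 : 0 < n%:R :> R.
    by rewrite ltr0n; near: n; exact: nbhs_infty_gt.
  rewrite -ler_expR lnK//; near: n; exact: nbhs_infty_ger.
apply/cvgryPge => A; near=> n.
have n2 : (2 <= n)%N by near: n; exact: nbhs_infty_ge.
have lA : `|A| <= ln n%:R by near: n; exact: (cvgry_ge lnoo).
have l0 : 0 < ln n%:R :> R by exact: ln_gt0n.
have m0 := m_gt0 n2.
have mA : 2 * `|A| <= m n.
  suff : 2 * `|A| + 1 <= (p n)%:R by lra.
  near: n; exact: (p_oo (nbhs_infty_ger (2 * `|A| + 1))).
apply: (le_trans (ler_norm A)).
have -> : vfactor n = m n * (1 - expR (- (4 * ln n%:R / m n))).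
  rewrite /vfactor /t_ -expRM_natl; congr (_ * (1 - expR _)).
  by field; rewrite gt_eqF.
move: m0 mA lA l0; move: (m n) (ln _) => M l m0 mA lA l0.
(* From e ^ -y <= 1 / (1 + y), v is at least 4 l M / (M + 4 l), which is large as soon as M = p - 1
   and l = ln n both are, at whatever relative rate. *)
set y := 4 * l / M.
have y0 : 0 < y by rewrite divr_gt0// mulr_gt0.
have hy : expR (- y) <= (1 + y)^-1.
  by rewrite expRN lef_pV2 ?posrE ?expR_gt0 ?addr_gt0// expR_ge1Dx.
apply: (@le_trans _ _ (M * (1 - (1 + y)^-1))); last first.
  by rewrite ler_wpM2l ?(ltW m0)// lerD2l lerN2.
have -> : M * (1 - (1 + y)^-1) = 4 * l * M / (M + 4 * l).
  by rewrite /y; field; rewrite !gt_eqF// ?addr_gt0 ?mulr_gt0.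
rewrite ler_pdivlMr ?addr_gt0 ?mulr_gt0//.
have : `|A| * M <= l * M by rewrite ler_wpM2r// ltW.
have : 2 * `|A| * (2 * l) <= M * (2 * l) by rewrite ler_wpM2r// mulr_ge0// ltW.
have := mulr_gt0 l0 m0; lra.
Unshelve. all: by end_near. Qed.

Let asin_itv n : (2 <= n)%N -> 0 < asin (t n) < pi / 2.
Proof.
move=> n2; have /andP[t0 t1] := t_itv n2; have pi0 := pi_gt0 R.
have t11 : -1 <= t n <= 1 by apply/andP; split; lra.
rewrite asin_ltpi2 ?andbT; last by apply/andP; split; lra.
rewrite ltNge; apply/negP => h.
have : 0 <= - t n.
  rewrite -[t n]asinK ?in_itv// -sinN; apply: sin_ge0_pi.
  by have := asin_geNpi2 t11; move: h; lra.
by move: t0; lra.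
Qed.

Section fixed_x.
Variable x : R.
Local Notation lam n := (x + ln (vfactor n)).
Local Notation b n := (asin (t n)).
Local Notation th n := (threshold n x).
Local Notation q n := (p n - 2)%N.
Local Notation kap n := (lam n ^+ 2 / vfactor n).
Local Notation C n := (cos (th n) / cos (b n)).
Local Notation S n := (sin (th n) / sin (b n)).

Let sinb n : (2 <= n)%N -> sin (b n) = t n.
Proof.
move=> n2; have /andP[t0 t1] := t_itv n2.
by rewrite asinK// in_itv/=; apply/andP; split; lra.
Qed.

Let cosb n : (2 <= n)%N -> cos (b n) = Num.sqrt (1 - t n ^+ 2).
Proof.
move=> n2; have /andP[t0 t1] := t_itv n2.
by rewrite cos_asin//; apply/andP; split; lra.
Qed.

Let vE n : (2 <= n)%N -> vfactor n = (q n).+1%:R * cos (b n) ^+ 2.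
Proof. by move=> n2; rewrite /vfactor mE// cos2sin2 sinb. Qed.

Let thE n : (2 <= n)%N ->
  th n = b n + sin (b n) / (2 * (q n).+1%:R * cos (b n)) * lam n.
Proof. by move=> n2; rewrite /threshold /alpha_ sinb// cosb// mE. Qed.

Let kap_cvg : kap n @[n --> \oo] --> 0.
Proof. exact: cvg_sqr_lnV cvg_vfactor. Qed.

Let vV_cvg : (vfactor n)^-1 @[n --> \oo] --> 0.
Proof. by apply/gtr0_cvgV0 => //; [exact: (cvgry_gt cvg_vfactor)|exact: cvg_vfactor]. Qed.

Let eta_cvg : 2 * kap n + (vfactor n)^-1 @[n --> \oo] --> 0.
Proof.
rewrite [X in _ --> X](_ : _ = 2 * 0 + 0); last by rewrite mulr0 addr0.
by apply: cvgD => //; apply: cvgM => //; exact: cvg_cst.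
Qed.

(** The hypotheses of the perturbation estimates at rank n, with [vfactor n] written as there. *)
Let good n := [/\ (2 <= n)%N, 1 <= (q n).+1%:R * cos (b n) ^+ 2,
  lam n ^+ 2 / ((q n).+1%:R * cos (b n) ^+ 2) <= 4^-1 &
  2 * (lam n ^+ 2 / ((q n).+1%:R * cos (b n) ^+ 2)) +
    ((q n).+1%:R * cos (b n) ^+ 2)^-1 < 1].

Let near_good : \forall n \near \oo, good n.
Proof.
near=> n; have n2 : (2 <= n)%N by near: n; exact: nbhs_infty_ge.
split => //; rewrite -vE//; near: n.
- exact: (cvgry_ge cvg_vfactor).
- by apply: (cvgr_le _ kap_cvg); rewrite invr_gt0.
- exact: (cvgr_lt _ eta_cvg).
Unshelve. all: by end_near. Qed.

Lemma near_threshold : \forall n \near \oo, 0 < th n < pi / 2.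
Proof.
apply: filterS near_good => n [n2 g1 g2 g3].
by rewrite thE//; apply: perturbed_angle_itv => //; exact: asin_itv.
Qed.

Let C_cvg : C n @[n --> \oo] --> (1 : R).
Proof.
apply/cvgrPdist_le => e e0; near=> n.
have [n2 g1 g2 g3] : good n by near: n; exact: near_good.
rewrite distrC thE//.
apply: (le_trans (perturbed_cos (lam n) (ltn0Sn (q n)) (asin_itv n2) g1)).
by rewrite -vE//; near: n; apply: (cvgr_le _ eta_cvg).
Unshelve. all: by end_near. Qed.

Let err n := (q n).+1%:R * ln (S n) - lam n / 2.

Let err_cvg : err n @[n --> \oo] --> 0.
Proof.
apply/cvgr0Pnorm_le => e e0; near=> n.
have [n2 g1 g2 g3] : good n by near: n; exact: near_good.
rewrite /err thE//.
apply: (le_trans (perturbed_sin (ltn0Sn (q n)) (asin_itv n2) g1 g2)).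
rewrite -vE//; near: n.
have : 3 * kap n @[n --> \oo] --> (3 * 0 : R) by apply: cvgM => //; exact: cvg_cst.
by rewrite mulr0 => /cvgr_le; apply.
Unshelve. all: by end_near. Qed.

(** n ^ 2 times the upper bound of [sin_int_upper] over Wallis' integral, after both cancellations;
    only factors with known limits remain. *)
Let U n := expR (x / 2) * expR (err n) /
  (C n * (Num.sqrt (q n).+1%:R * wallis (q n))).

Let U_cvg : U n @[n --> \oo] --> expR (x / 2) / Num.sqrt (2 * pi).
Proof.
have q_oo : q n @[n --> \oo] --> \oo.
  move=> A [N _ NA]; have [M _ MA] := p_oo (nbhs_infty_ge (N + 2)).
  by exists M => // n /MA /= h; apply: NA => /=; lia.
rewrite [X in _ --> X](_ : _ =
    expR (x / 2) * expR 0 / (1 * Num.sqrt (2 * pi))); last first.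
  by rewrite expR0 mulr1 mul1r.
apply: cvgM.
  apply: cvgM; first exact: cvg_cst.
  by apply: cvg_continuous_comp => //; exact: continuous_expR.
apply: cvgV; first by rewrite mul1r gt_eqF// sqrtr_gt0 mulr_gt0// pi_gt0.
by apply: cvgM => //; exact: (cvg_comp _ _ q_oo cvg_sqrt_wallis).
Qed.

Lemma cap_asymptotics :
  n%:R ^+ 2 * (sin_int (q n) (th n) / wallis (q n)) @[n --> \oo]
    --> expR (x / 2) / Num.sqrt (2 * pi).
Proof.
(* The correction of [sin_int_lower]: (p - 1) cos ^ 2 at the threshold is [vfactor n * C n ^+ 2], so
   it tends to 1. *)
have L_cvg : U n / (1 + (vfactor n * C n ^+ 2)^-1) @[n --> \oo]
    --> expR (x / 2) / Num.sqrt (2 * pi).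
  rewrite [X in _ --> X](_ : _ =
      expR (x / 2) / Num.sqrt (2 * pi) / (1 + 0 * (1 * 1)^-1)); last first.
    by rewrite mul0r addr0 divr1.
  apply: cvgM => //; apply: cvgV; first by rewrite mul0r addr0 oner_eq0.
  apply: cvgD; first exact: cvg_cst.
  under eq_fun do rewrite invfM expr2.
  by apply: cvgM => //; apply: cvgV; [rewrite mul1r oner_eq0|exact: cvgM].
apply: (squeeze_cvgr _ L_cvg U_cvg).
near=> n.
have [n2 g1 g2 g3] : good n by near: n; exact: near_good.
have th_itv : 0 < th n < pi / 2 by near: n; exact: near_threshold.
have b_itv := asin_itv n2.
have S0 : 0 < S n by rewrite thE//; exact: perturbed_sin_gt0.
have c0 : 0 < cos (b n).
  by apply: cos_gt0_pihalf; case/andP: b_itv => ? ?; apply/andP; split; lra.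
have cth : 0 < cos (th n).
  by apply: cos_gt0_pihalf; case/andP: th_itv => ? ?; apply/andP; split; lra.
have s0 : 0 < sin (b n) by exact: sin_gt0_pihalf.
have w0 := wallis_gt0 (R := R) (q n).
have q0 : 0 < (q n).+1%:R :> R by [].
have n0 : 0 < n%:R ^+ 2 :> R by rewrite exprn_gt0// ltr0n; lia.
have UE : U n = n%:R ^+ 2 *
    (sin (th n) ^+ (q n).+1 / ((q n).+1%:R * cos (th n)) / wallis (q n)).
  have -> : sin (th n) = t n * S n by rewrite -{1}(sinb n2) mulrC divfK// gt_eqF.
  rewrite exprMn !mulrA tX// mul1r.
  have -> : S n ^+ (q n).+1 =
      expR (x / 2) * expR (err n) * (Num.sqrt (q n).+1%:R * cos (b n)).
    have -> : Num.sqrt (q n).+1%:R * cos (b n) = expR (ln (vfactor n) / 2).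
      apply/eqP; rewrite -(@eqrXn2 _ 2) ?mulr_ge0 ?expR_ge0 ?sqrtr_ge0 ?(ltW c0)//.
      rewrite exprMn sqr_sqrtr// -vE// -expRM_natl.
      rewrite (_ : 2%:R * _ = ln (vfactor n)); last by field.
      by rewrite lnK// posrE vE// (lt_le_trans _ g1).
    rewrite -!expRD -[S n in LHS]lnK// -expRM_natl; congr expR.
    by rewrite /err; field.
  have qE := sqr_sqrtr (ltW q0).
  have r0 : 0 < Num.sqrt (q n).+1%:R :> R by rewrite sqrtr_gt0.
  rewrite /U; set r := Num.sqrt _ in qE r0 *; rewrite -qE.
  by field; rewrite !gt_eqF.
have up := sin_int_upper (q n) th_itv.
have lo := sin_int_lower (q n) th_itv.
rewrite UE; apply/andP; split.
  rewrite ler_pdivrMr; last first.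
    by rewrite ltr_wpDr// invr_ge0 mulr_ge0 ?sqr_ge0// vE// (le_trans _ g1).
  rewrite -[leRHS]mulrA ler_pM2l// [leRHS]mulrAC ler_pM2r ?invr_gt0//.
  rewrite ler_pdivrMr ?mulr_gt0// [leRHS]mulrAC (le_trans lo)//.
  rewrite le_eqVlt; apply/orP; left; apply/eqP; congr (_ * (1 + _^-1)).
  by rewrite vE//; field; rewrite gt_eqF.
rewrite ler_pM2l// ler_pM2r ?invr_gt0// ler_pdivlMr ?mulr_gt0//.
Unshelve. all: by end_near. Qed.

End fixed_x.
End angular_threshold.

(** * Independence and the probability of having no bad pair *)

Section joint_law.
Local Open Scope ereal_scope.
Context d d1 d2 (T : measurableType d) (T1 : measurableType d1)
  (T2 : measurableType d2) (R : realType) (P : probability T R).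

(** The joint law agrees with the product measure on rectangles, hence everywhere; the product
    measure integrates the sections. *)
Lemma independent_section_measure (U : {RV P >-> T1}) (Y : {RV P >-> T2})
    (D : set (T1 * T2)) : measurable D ->
  (forall A B, measurable A -> measurable B ->
    P (U @^-1` A `&` Y @^-1` B) = P (U @^-1` A) * P (Y @^-1` B)) ->
  P [set w | D (U w, Y w)] =
    \int[distribution P U]_u distribution P Y (xsection D u).
Proof.
move=> mD indep.
have mUY : measurable_fun setT (fun w => (U w, Y w)).
  exact: measurable_fun_pair.
pose UY : {mfun T >-> (T1 * T2)%type} := HB.pack (fun w => (U w, Y w))
  (isMeasurableFun.Build _ _ _ _ (fun w => (U w, Y w)) mUY).
have := @product_measure_unique _ _ _ _ R (distribution P U) (distribution P Y)
  (distribution P UY) _ _ mD.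
by rewrite /product_measure1 => ->.
Qed.

End joint_law.

Section independence.
Local Open Scope ereal_scope.
Context d d' (T : measurableType d) (T' : measurableType d') (R : realType)
  (P : probability T R) (n : nat) (X : 'I_n -> {RV P >-> T'}).
Hypothesis X_indep : mutually_independent X.
Variable k : 'I_n.

(** A pi-system generating the sigma-algebra of all the [X i] with i different from k, that is, of
    what is known before [X k] is revealed. *)
Definition cylinders : set (set T) :=
  [set E | exists2 A : 'I_n -> set T', (forall i, measurable (A i)) &
    E = \bigcap_(i in [set i | i != k]) (X i @^-1` A i)].

Lemma cylinders_setI : setI_closed cylinders.
Proof.
move=> _ _ [A mA ->] [B mB ->]; exists (fun i => A i `&` B i).
  by move=> i; exact: measurableI.
by rewrite -bigcapI; apply: eq_bigcapr => i _; rewrite preimage_setI.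
Qed.

Lemma cylinders_preimage i A : i != k -> measurable A ->
  cylinders (X i @^-1` A).
Proof.
move=> ik mA; exists (fun j => if j == i then A else setT).
  by move=> j; case: ifP.
apply/seteqP; split => w /=.
  by move=> Aw j _ /=; case: eqP => [->|].
by move=> /(_ i ik); rewrite /= eqxx.
Qed.

Lemma measurable_cylinder_sigma E : <<s cylinders >> E -> measurable E.
Proof.
move: E; apply: smallest_sub; first exact: sigma_algebra_measurable.
move=> _ [A mA ->]; apply: fin_bigcap_measurable; first exact: finite_finset.
move=> i _.
exact: measurable_funPTI.
Qed.

Let cylinder_indep B E : measurable B -> cylinders E ->
  P (E `&` X k @^-1` B) = P E * P (X k @^-1` B).
Proof.
move=> mB [A mA ->].
pose A' i := if i == k then B else A i.
have mA' i : measurable (A' i) by rewrite /A'; case: ifP.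
have -> : \bigcap_(i in [set i | i != k]) (X i @^-1` A i) `&` X k @^-1` B =
    \bigcap_(i in [set` [set: 'I_n]%SET]) (X i @^-1` A' i).
  apply/seteqP; split => w /=.
    move=> [Aw Bw] i _; rewrite /A' /=; case: eqP => [->//|/eqP ik].
    exact: Aw.
  move=> Aw; split.
    by move=> i /= ik; have := Aw i; rewrite /= /A' (negbTE ik) finset.in_setT; exact.
  by have := Aw k; rewrite /= /A' eqxx finset.in_setT; exact.
have -> : \bigcap_(i in [set i | i != k]) (X i @^-1` A i) =
    \bigcap_(i in [set` [set~ k]%SET]) (X i @^-1` A' i).
  apply/seteqP; split => w /= Aw i /=.
    by rewrite finset.in_setC1 => ik; rewrite /A' (negbTE ik); exact: Aw.
  by move=> ik; have := Aw i; rewrite /= finset.in_setC1 /A' (negbTE ik); exact.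
rewrite !X_indep// (bigD1 k) ?finset.in_setT//= muleC.
rewrite (_ : A' k = B) ?/A' ?eqxx//; congr (_ * _).
by apply: eq_bigl => i; rewrite finset.in_setT finset.in_setC1.
Qed.

(** Pi-lambda argument: the events obeying the product formula form a Dynkin system that contains
    the pi-system [cylinders]. *)
Lemma cylinder_sigma_indep B E : measurable B -> <<s cylinders >> E ->
  P (E `&` X k @^-1` B) = P E * P (X k @^-1` B).
Proof.
move=> mB; have mXB : measurable (X k @^-1` B) by exact: measurable_funPTI.
pose H := [set E | measurable E /\
  P (E `&` X k @^-1` B) = P E * P (X k @^-1` B)].
suff : <<s cylinders >> `<=` H by move=> h /h [].
apply: lambda_system_subset => //; first exact: cylinders_setI.
- apply/dynkin_lambda_system; split.
  + by split => //; rewrite setTI probability_setT mul1e.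
  + move=> A [mA hA]; split; first exact: measurableC.
    rewrite setIC -setDE measureD//; last first.
      by rewrite (le_lt_trans (probability_le1 _ _)) ?ltry.
    rewrite [X in _ - X](_ : _ = P A * P (X k @^-1` B)); last first.
      by rewrite setIC; exact: hA.
    rewrite probability_setC// muleBl ?mul1e ?fin_num_measure//.

  + move=> F tF HF; split; first by apply: bigcup_measurable => i _; case: (HF i).
    have mF i : measurable (F i) by case: (HF i).
    rewrite setI_bigcupl measure_bigcup//; last 2 first.
      by move=> i _; exact: measurableI.
      by apply: trivIset_setIr.
    rewrite [X in _ = X * _]measure_bigcup// [RHS]muleC.
    rewrite -[X in _ = X * _]fineK ?fin_num_measure// -nneseriesZl//.
    apply: eq_eseriesr => i _; rewrite fineK ?fin_num_measure// muleC.
    by case: (HF i).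
- move=> F cF; split; last exact: cylinder_indep.
  by apply: measurable_cylinder_sigma; exact: sub_sigma_algebra.
Qed.

End independence.

Section uniform_pairs.
Context d (T : measurableType d) (R : realType) (P : probability T R)
  (n p : nat) (X : 'I_n -> {RV P >-> p.-tuple R}).
Hypothesis X_unif : forall i, uniform_on_sphere (X i).
Hypothesis X_indep : mutually_independent X.

Lemma uniform_ae i : {ae P, forall w, unit_sphere (X i w)}.
Proof.
have mS := @measurable_unit_sphere R p.
exists (X i @^-1` ~` (@unit_sphere R p)); split => //.
  by apply: measurable_funPTI; exact: measurableC.
have := probability_setC (distribution P (X i)) mS.
by rewrite [X in _ = (1 - X)%E](X_unif i).1 subee.
Qed.

Definition dot_event (B : set R) (i k : 'I_n) : set T :=
  [set w | B (dotp (X i w) (X k w))].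

Lemma measurable_sigma_dot B i j k : measurable B -> i != k -> j != k ->
  <<s cylinders X k >> (dot_event B i j).
Proof.
move=> mB ik jk.
have mX l : l != k ->
    measurable_fun [set: g_sigma_algebraType (cylinders X k)] (X l).
  move=> lk _ A mA; rewrite setTI; apply: sub_sigma_algebra.
  exact: cylinders_preimage.
have mXX := measurable_fun_pair (mX i ik) (mX j jk).
have := (measurableT_comp measurable_dotp mXX) measurableT B mB.
by rewrite setTI.
Qed.

Lemma measurable_dot_event B i k : measurable B -> measurable (dot_event B i k).
Proof.
move=> mB.
have mXX : measurable_fun setT (fun w => (X i w, X k w)).
  exact: measurable_fun_pair.
have := (measurableT_comp measurable_dotp mXX) measurableT B mB.
by rewrite setTI.
Qed.

(* Pairing [X i] with the indicator of [E] makes [E], [X i] jointly independent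
   of [X k], so that integrating first over [X k] gives the constant [q]. *)
Lemma dot_event_indep B q i k E : measurable B -> i != k ->
  (forall z, unit_sphere z -> distribution P (X k) (dotp z @^-1` B) = q%:E) ->
  <<s cylinders X k >> E ->
  P (E `&` dot_event B i k) = (P E * q%:E)%E.
Proof.
move=> mB ik qE sE.
have mE : measurable E by apply: measurable_cylinder_sigma sE.
have msU : measurable_fun [set: g_sigma_algebraType (cylinders X k)]
    (fun w => (X i w, `[<E w>])).
  apply: measurable_fun_pair.
    move=> _ A mA; rewrite setTI; apply: sub_sigma_algebra.
    exact: cylinders_preimage.
  apply: (measurable_fun_bool true); rewrite setTI.
  rewrite (_ : _ @^-1` _ = E)//.
  by apply/seteqP; split => w /=; [move=> /asboolP|move=> ?; apply/asboolP].
have sub : forall F, <<s cylinders X k >> F -> measurable F.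
  by move=> F; exact: measurable_cylinder_sigma.
have mU : measurable_fun [set: T] (fun w => (X i w, `[<E w>])).
  by move=> _ A mA; apply: sub; exact: msU.
pose U : {mfun T >-> (p.-tuple R * bool)%type} := HB.pack
  (fun w => (X i w, `[<E w>]))
  (isMeasurableFun.Build _ _ _ _ (fun w => (X i w, `[<E w>])) mU).
pose D := [set u : (p.-tuple R * bool) * p.-tuple R |
  u.1.2 /\ B (dotp u.1.1 u.2)].
have mD : measurable D.
  have m2 : measurable_fun setT
      (fun u : (p.-tuple R * bool) * p.-tuple R => u.1.2).
    exact: (measurableT_comp measurable_snd measurable_fst).
  have m1 : measurable_fun setT
      (fun u : (p.-tuple R * bool) * p.-tuple R => (u.1.1, u.2)).
    apply: measurable_fun_pair => //.
    exact: (measurableT_comp measurable_fst measurable_fst).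
  have m1B := (measurableT_comp measurable_dotp m1) measurableT B mB.
  have mt : measurable ([set true] : set bool) by [].
  have m2B := m2 measurableT _ mt.
  by rewrite setTI in m1B; rewrite setTI in m2B; exact: (measurableI _ _ m2B m1B).
have -> : E `&` dot_event B i k = [set w | D (U w, X k w)].
  apply/seteqP; split => w /= [Ew Bw]; split => //; first exact/asboolP.
  by move/asboolP : Ew.
rewrite (independent_section_measure mD); last first.
  move=> A C mA mC; apply: (cylinder_sigma_indep X_indep) => //.
  have := msU measurableT A mA; by rewrite setTI.
rewrite ge0_integral_distribution//; last exact: measurable_fun_xsection.
(* Almost surely [X i w] is a unit vector: the section of [D] then has measure q when w is in [E],
   and is empty otherwise. *)
transitivity (\int[P]_w (q%:E * (\1_E w)%:E))%E.
  apply: ae_eq_integral => //.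
  - apply: measurableT_comp => //; exact: measurable_fun_xsection.
  - by apply: measurable_funeM; apply/measurable_EFinP; exact: measurable_indic.
  have := uniform_ae i; apply: filterS => w Sw _ /=.
  rewrite indicE; have [Ew|Ew] := pselect (E w).
    rewrite mem_set// mule1 -(qE _ Sw); congr (P (X k @^-1` _)).
    apply/seteqP; split => y; rewrite /xsection /= inE /D /=; first by case.
    by move=> By; split => //; exact/asboolP.
  rewrite memNset// mule0 (_ : xsection _ _ = set0) ?measure0//.
  apply/seteqP; split => y //; rewrite /xsection /= inE /D /= => -[/asboolP].
  by [].
by rewrite integralZl// ?integral_indic ?setIT 1?muleC//; exact: integrable_indic.
Qed.

Lemma dot_event_probability B q i k : measurable B -> i != k ->
  (forall z, unit_sphere z -> distribution P (X k) (dotp z @^-1` B) = q%:E) ->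
  P (dot_event B i k) = q%:E.
Proof.
move=> mB ik qE; rewrite -[dot_event _ _ _]setTI (dot_event_indep mB ik qE).
  by rewrite probability_setT mul1e.
exact: (@measurableT _ (g_sigma_algebraType (cylinders X k))).
Qed.

End uniform_pairs.

(** * Avoiding all bad pairs, one point at a time *)

Section pair_events.
Context d (T : measurableType d) (R : realType) (P : probability T R).
Local Notation pr A := (fine (P A)).

Let prU A B : measurable A -> measurable B ->
  pr (A `|` B) = pr A + pr B - pr (A `&` B).
Proof.
move=> mA mB.
have mBA := measurableD mB mA; have mBI := measurableI _ _ mB mA.
have -> : A `|` B = A `|` (B `\` A).
  apply/seteqP; split => w /= [Aw|Bw]; [by left| |by left|by right; case: Bw].
  by have [Aw|nAw] := pselect (A w); [left|right].
rewrite measureU//; last by rewrite setDE setICA setICr setI0.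
have := measureDI P mB mA => /(congr1 fine).
rewrite !fineD ?fin_num_measure// => ->; rewrite setIC; ring.
Qed.

Let pr_le A B : measurable A -> measurable B -> A `<=` B -> pr A <= pr B.
Proof.
move=> mA mB AB; rewrite fine_le ?fin_num_measure// le_measure ?inE//.
Qed.

Variables (A : nat -> nat -> set T) (n : nat) (q : R).
Hypothesis mA : forall i j, measurable (A i j).

Definition avoid (k : nat) : set T :=
  [set w | forall i j, (i < j < k)%N -> ~ A i j w].

Hypothesis avoid_indep : forall i k, (i < k < n)%N ->
  P (avoid k `&` A i k) = (P (avoid k) * q%:E)%E.
Hypothesis pair_indep : forall i j k, (i < j)%N -> (j < k < n)%N ->
  P (A i k `&` A j k) = (q * q)%:E.
Hypothesis q_ge0 : 0 <= q.

(** Point k is bad with one of the first l points; l grows up to k by induction. *)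
Let U k l := \big[setU/set0]_(i < l) A i k.

Let mU k l : measurable (U k l).
Proof. exact: bigsetU_measurable. Qed.

Lemma avoidS k : avoid k.+1 = avoid k `\` U k k.
Proof.
apply/seteqP; split => w /=.
  move=> h; split => [i j /andP[ij jk]|]; first by apply: h; rewrite ij ltnS ltnW.
  rewrite /U -(bigcup_mkord k (fun i => A i k)) => -[i /= ik].
  by apply: h; rewrite ik ltnSn.
move=> [h1 h2] i j /andP[ij]; rewrite ltnS leq_eqVlt => /orP[/eqP jk|jk].
  move=> Aij; apply: h2; rewrite /U -(bigcup_mkord k (fun i => A i k)).
  by exists i; rewrite -jk.
by apply: h1; rewrite ij.
Qed.

Lemma measurable_avoid k : measurable (avoid k).
Proof.
elim: k => [|k ih]; last by rewrite avoidS; exact: measurableD.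
rewrite (_ : avoid 0 = setT)//; apply/seteqP; split => w //= _ i j.
by rewrite ltn0 andbF.
Qed.

Let pr_UI k l l' : (l <= l')%N -> (l' < k < n)%N ->
  pr (U k l `&` A l' k) <= l%:R * (q * q).
Proof.
elim: l => [|l ih] ll' l'k; first by rewrite /U big_ord0 set0I measure0 mul0r.
rewrite /U big_ord_recr/= -/(U k l) setIUl prU; try exact: measurableI.
rewrite pair_indep// -natr1 mulrDl mul1r.
have := ih (ltnW ll') l'k.
have : 0 <= pr (U k l `&` A l' k `&` (A l k `&` A l' k)) by exact: fine_ge0.
rewrite /=; lra.
Qed.

(** Each new event adds exactly q pr (avoid k), minus an overlap between 0 and l q ^ 2 by [pr_UI];
    the overlaps add up to at most l ^ 2 q ^ 2. *)
Let pr_avoidI k l : (l <= k < n)%N ->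
  l%:R * (q * pr (avoid k)) - l%:R ^+ 2 * (q * q) <= pr (avoid k `&` U k l)
  <= l%:R * (q * pr (avoid k)).
Proof.
move=> /andP[lk kn]; elim: l lk => [|l ih] lk.
  by rewrite /U big_ord0 setI0 measure0 !mul0r expr0n/= mul0r subr0 lexx.
have /andP[ih1 ih2] := ih (ltnW lk).
have mV := measurable_avoid k.
have mVA := measurableI _ _ mV (mA l k).
have mVU := measurableI _ _ mV (mU k l).
rewrite /U big_ord_recr/= -/(U k l) setIUr prU//.
rewrite avoid_indep ?lk// fineM ?fin_num_measure//=.
have h0 : 0 <= pr (avoid k `&` U k l `&` (avoid k `&` A l k)) by exact: fine_ge0.
have h1 : pr (avoid k `&` U k l `&` (avoid k `&` A l k)) <= l%:R * (q * q).
  apply: le_trans (pr_UI (leqnn l) (k := k) _); last by rewrite lk.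
  apply: pr_le; [exact: measurableI|exact: measurableI|].
  by move=> w [[_ ?] [_ ?]].
have l0 : 0 <= l%:R :> R by [].
have qq : 0 <= q * q by exact: mulr_ge0.
have lqq : 0 <= l%:R * (q * q) by exact: mulr_ge0.
rewrite -natr1; apply/andP; split; last by lra.
move: ih1 ih2 h0 h1; lra.
Qed.

Lemma avoid_step k : (k < n)%N ->
  (1 - k%:R * q) * pr (avoid k) <= pr (avoid k.+1) <=
  (1 - k%:R * q) * pr (avoid k) + k%:R ^+ 2 * (q * q).
Proof.
move=> kn; have := @pr_avoidI k k; rewrite leqnn kn => /(_ isT) /andP[h1 h2].
have mV := measurable_avoid k.
have := measureDI P mV (mU k k) => /(congr1 fine).
rewrite fineD ?fin_num_measure//; try exact: measurableD; try exact: measurableI.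
rewrite -avoidS => h; apply/andP; split; move: h1 h2 h; rewrite /=; lra.
Qed.

Hypothesis q_le : n%:R * q <= 1.

(** Since n q <= 1 the factors 1 - k q lie in [0, 1], so the error of each step is never amplified
    by later ones and the errors just add up. *)
Lemma avoid_bounds k : (k <= n)%N ->
  \prod_(i < k) (1 - i%:R * q) <= pr (avoid k) <=
  \prod_(i < k) (1 - i%:R * q) + k%:R * (n%:R ^+ 2 * (q * q)).
Proof.
have qq : 0 <= q * q by exact: mulr_ge0.
have nqq : 0 <= n%:R ^+ 2 * (q * q) by rewrite mulr_ge0// exprn_ge0.
elim: k => [|k ih] kn.
  rewrite big_ord0 mul0r addr0 (_ : avoid 0 = setT) ?probability_setT ?lexx//.
  by apply/seteqP; split => w //= _ i j; rewrite ltn0 andbF.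
have /andP[ih1 ih2] := ih (ltnW kn); have /andP[s1 s2] := avoid_step kn.
have kn' : k%:R <= n%:R :> R by rewrite ler_nat ltnW.
have kq : 0 <= 1 - k%:R * q.
  by rewrite subr_ge0 (le_trans _ q_le)// ler_wpM2r.
have kq1 : 0 <= k%:R * q by rewrite mulr_ge0.
have k2 : k%:R ^+ 2 * (q * q) <= n%:R ^+ 2 * (q * q).
  by rewrite ler_wpM2r// ler_sqr ?nnegrE.
rewrite big_ord_recr/= -natr1 mulrDl mul1r; apply/andP; split.
  by apply: le_trans s1; rewrite mulrC ler_wpM2l.
apply: (le_trans s2); rewrite addrA lerD//.
apply: (@le_trans _ _ ((1 - k%:R * q) * (\prod_(i < k) (1 - i%:R * q) +
    k%:R * (n%:R ^+ 2 * (q * q))))); first by rewrite ler_wpM2l.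
rewrite mulrDr [_ * \prod_(_ < _) _]mulrC lerD2l ler_piMl ?mulr_ge0//; lra.
Qed.

End pair_events.

Section product_limit.
Context {R : realType}.

Lemma cvg_near_eq (f g : nat -> R) (l : R) : (\forall n \near \oo, f n = g n) ->
  f n @[n --> \oo] --> l -> g n @[n --> \oo] --> l.
Proof. by move=> fg; apply: cvg_trans; exact: near_eq_cvg. Qed.

(** Each factor 1 - y, with y = i q <= 1/2, lies between e ^ (- y - 2 y ^ 2) and e ^ (- y); the
    indices below l sum to l (l - 1) / 2. *)
Lemma prod_bounds (n : nat) (q : R) l : 0 <= q -> n%:R * q <= 2^-1 -> (l <= n)%N ->
  expR (- (l%:R * (l%:R - 1) / 2 * q) - l%:R * (2 * (n%:R ^+ 2 * (q * q)))) <=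
  \prod_(i < l) (1 - i%:R * q) <= expR (- (l%:R * (l%:R - 1) / 2 * q)).
Proof.
move=> q0 nq; elim: l => [|l ih] ln.
  by rewrite big_ord0 !mul0r oppr0 addr0 expR0 lexx.
have /andP[ih1 ih2] := ih (ltnW ln).
set y := l%:R * q.
have ln' : l%:R <= n%:R :> R by rewrite ler_nat ltnW.
have y0 : 0 <= y by rewrite mulr_ge0.
have y2 : y <= 2^-1 by apply: le_trans nq; rewrite ler_wpM2r.
have yy : y ^+ 2 <= n%:R ^+ 2 * (q * q).
  by rewrite /y exprMn -expr2 ler_wpM2r ?sqr_ge0// ler_sqr ?nnegrE.
have up : 1 - y <= expR (- y) by exact: expR_ge1Dx.
have lo : expR (- y - 2 * (n%:R ^+ 2 * (q * q))) <= 1 - y.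
  rewrite -[leRHS]lnK ?posrE; last by lra.
  rewrite ler_expR; apply: le_trans (ln1D_ge (_ : - 2^-1 <= - y)); last by lra.
  by rewrite sqrrN lerD2l lerN2 ler_wpM2l.
rewrite big_ord_recr/=.
have -> : - (l.+1%:R * (l.+1%:R - 1) / 2 * q) = - (l%:R * (l%:R - 1) / 2 * q) + - y.
  by rewrite /y -natr1; field.
apply/andP; split; last first.
  have y1 : 0 <= 1 - y by lra.
  by rewrite expRD ler_pM// (le_trans _ ih1)// expR_ge0.
apply: le_trans (ler_pM _ _ ih1 lo); rewrite ?expR_ge0//.
by rewrite -expRD ler_expR -natr1 le_eqVlt; apply/orP; left; apply/eqP; ring.
Qed.

(** The smallness comes from n q = (n ^ 2 q) / n and n ^ 3 q ^ 2 = (n ^ 2 q)(n q). *)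
Lemma cvg_birthday_prod (q : nat -> R) (L : R) : (forall n, 0 <= q n) ->
  n%:R ^+ 2 * q n @[n --> \oo] --> L ->
  [/\ \prod_(i < n) (1 - i%:R * q n) @[n --> \oo] --> expR (- (L / 2)),
     n%:R * q n @[n --> \oo] --> (0 : R) &
     n%:R * (n%:R ^+ 2 * (q n * q n)) @[n --> \oo] --> (0 : R)].
Proof.
move=> q0 qL.
have nV : n%:R^-1 @[n --> \oo] --> (0 : R).
  by rewrite -cvg_shiftS; exact: cvg_harmonic.
have nq : n%:R * q n @[n --> \oo] --> (0 : R).
  rewrite -(mulr0 L); apply: (@cvg_near_eq (fun n => n%:R ^+ 2 * q n * n%:R^-1)).
    near=> n; have n0 : 0 < n%:R :> R.
      by rewrite ltr0n; near: n; exact: nbhs_infty_gt.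
    by field; rewrite gt_eqF.
  exact: cvgM.
have n3 : n%:R * (n%:R ^+ 2 * (q n * q n)) @[n --> \oo] --> (0 : R).
  rewrite -(mulr0 L); apply: (@cvg_near_eq (fun n => n%:R ^+ 2 * q n * (n%:R * q n))).
    by apply: nearW => n; ring.
  exact: cvgM.
split => //.
have s : n%:R * (n%:R - 1) / 2 * q n @[n --> \oo] --> L / 2.
  rewrite -[L]subr0; apply: (@cvg_near_eq
      (fun n => (n%:R ^+ 2 * q n - n%:R * q n) / 2)).
    by apply: nearW => n; ring.
  by apply: cvgM; [exact: cvgB|exact: cvg_cst].
apply: (@squeeze_cvgr _ _ _ _
  (fun n => expR (- (n%:R * (n%:R - 1) / 2 * q n) -
                  n%:R * (2 * (n%:R ^+ 2 * (q n * q n)))))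
  (fun n => expR (- (n%:R * (n%:R - 1) / 2 * q n)))).
- near=> n; apply: prod_bounds => //.
  by near: n; apply: (cvgr_le _ nq); rewrite invr_gt0.
- apply: cvg_continuous_comp; first exact: continuous_expR.
  rewrite [X in _ --> X](_ : _ = - (L / 2) - 2 * 0); last by rewrite mulr0 subr0.
  apply: cvgB; first exact: cvgN.
  apply: (@cvg_near_eq (fun n => 2 * (n%:R * (n%:R ^+ 2 * (q n * q n))))).
    by apply: nearW => n; ring.
  by apply: cvgM => //; exact: cvg_cst.
- apply: cvg_continuous_comp; first exact: continuous_expR.
  exact: cvgN.
Unshelve. all: by end_near. Qed.

End product_limit.

Section void_probability.
Context d (T : measurableType d) (R : realType) (P : probability T R)
  (n p : nat) (X : 'I_n -> {RV P >-> p.-tuple R}).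
Hypothesis X_unif : forall i, uniform_on_sphere (X i).
Hypothesis X_indep : mutually_independent X.

Lemma void_bounds (B : set R) (q : R) : measurable B -> 0 <= q -> n%:R * q <= 1 ->
  (forall k z, unit_sphere z -> distribution P (X k) (dotp z @^-1` B) = q%:E) ->
  \prod_(i < n) (1 - i%:R * q) <=
    fine (P [set w | forall i j : 'I_n, (i < j)%N -> ~ B (dotp (X i w) (X j w))])
  <= \prod_(i < n) (1 - i%:R * q) + n%:R * (n%:R ^+ 2 * (q * q)).
Proof.
move=> mB q0 nq qE.
case: n X X_unif X_indep nq qE => [|m] Y Y_unif Y_indep nq qE.
  rewrite big_ord0 mul0r addr0 (_ : [set w | _] = setT) ?probability_setT ?lexx//.
  by apply/seteqP; split => w //= _ [].
(* Natural-number indices suit the induction on points; [inord] needs a nonempty index type, whence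
   the separate case n = 0, and is faithful below [m.+1]. *)
pose A i j := dot_event Y B (inord i) (inord j).
have -> : [set w | forall i j : 'I_m.+1, (i < j)%N -> ~ B (dotp (Y i w) (Y j w))]
    = avoid A m.+1.
  apply/seteqP; split => w /= h i j.
    move=> /andP[ij jm]; apply: h; rewrite !inordK//.
    by rewrite (ltn_trans ij).
  by move=> ij; have := h i j; rewrite /A /dot_event /= !inord_val ij ltn_ord; exact.
have mA i j : measurable (A i j) by exact: measurable_dot_event.
have inord_neq i j : (i < j)%N -> (j < m.+1)%N -> inord i != inord j :> 'I_m.+1.
  move=> ij jm; apply/negP => /eqP /(congr1 val) /=.
  by rewrite !inordK// ?(ltn_trans ij)//; lia.
have sA i j l : (i < m.+1)%N -> (j < m.+1)%N -> (l < m.+1)%N -> i != l -> j != l ->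
    <<s cylinders Y (inord l) >> (A i j).
  move=> im jm lm il jl; apply: measurable_sigma_dot => //.
    by case: (ltngtP i l) il => // h _; [|rewrite eq_sym]; exact: inord_neq.
  by case: (ltngtP j l) jl => // h _; [|rewrite eq_sym]; exact: inord_neq.
apply: avoid_bounds => //.
- move=> i k /andP[ik km]; apply: (dot_event_indep Y_unif Y_indep) => //.
  + exact: inord_neq.
  + exact: qE.
  suff h l : (l <= k)%N ->
      (measurable : set (set (g_sigma_algebraType (cylinders Y (inord k)))))
      (avoid A l) by exact: h.
  elim: l => [|l ih] lk.
    rewrite (_ : avoid A 0 = setT); first exact: measurableT.
    by apply/seteqP; split => w //= _ a b; rewrite ltn0 andbF.
  rewrite avoidS; apply: measurableD; first by apply: ih; exact: ltnW.
  apply: bigsetU_measurable => a _; have al := ltn_ord a.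
  have := sA a l k; rewrite /measurable /=; apply; lia.
- move=> i j k ij /andP[jk km].
  (* Both events involve point k, but [A i k] does not involve point j; reading the second pair as
     (k, j) makes j the independent point. *)
  have -> : A j k = dot_event Y B (inord k) (inord j).
    by apply/seteqP; split => w; rewrite /A /dot_event /= dotpC.
  rewrite (dot_event_indep Y_unif Y_indep (q := q))//.
  + rewrite (dot_event_probability Y_unif Y_indep (q := q))//.
    * by apply: inord_neq => //; lia.
    * exact: qE.
  + by rewrite eq_sym; exact: inord_neq.
  + exact: qE.
  + by apply: sA; lia.
Qed.

Definition two_caps (a b : R) : set R := `[cos a, +oo[ `|` `]-oo, - cos b].

Lemma measurable_two_caps a b : measurable (two_caps a b).
Proof. exact: measurableU. Qed.

(** The second cap is a cap around -z. The angles being below pi / 2, both cosines are positive and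
    the caps are disjoint. *)
Lemma two_caps_law k z a b : (2 <= p)%N -> unit_sphere z ->
  0 < a < pi / 2 -> 0 < b < pi / 2 ->
  distribution P (X k) (dotp z @^-1` two_caps a b) =
  (sin_int (p - 2) a / wallis (p - 2) + sin_int (p - 2) b / wallis (p - 2))%:E.
Proof.
move=> p2 Sz /andP[a0 a2] /andP[b0 b2]; have pi0 := pi_gt0 R.
set mu := distribution P (X k).
have inv : @rotation_invariant R p mu by exact: X_unif.
have p0 : (0 < p)%N by lia.
pose z' : p.-tuple R := [tuple - tnth z i | i < p].
have zz' y : dotp z' y = - dotp z y.
  by rewrite /dotp -sumrN; apply: eq_bigr => i _; rewrite tnth_mktuple mulNr.
have Sz' : unit_sphere z'.
  apply/unit_sphereP; rewrite zz' dotpC zz' opprK; exact/unit_sphereP.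
have mz : measurable_fun setT (dotp z) by exact: measurable_dotpr.
have m1 : measurable (dotp z @^-1` `[cos a, +oo[).
  by rewrite -[_ @^-1` _]setTI; exact: mz.
have m2 : measurable (dotp z @^-1` `]-oo, - cos b]).
  by rewrite -[_ @^-1` _]setTI; exact: mz.
have ca : 0 < cos a by apply: cos_gt0_pihalf; apply/andP; split; lra.
have cb : 0 < cos b by apply: cos_gt0_pihalf; apply/andP; split; lra.
rewrite /two_caps preimage_setU [LHS]measureU//; last first.
  apply/seteqP; split => y //=; rewrite !in_itv/= andbT; lra.
rewrite EFinD; congr (_ + _)%E.
  rewrite -(sphere_cap inv p2 (Ordinal p0) Sz); last by apply/andP; split; lra.
  rewrite fineK ?fin_num_measure//.
    by congr (mu _); apply/seteqP; split => y /=; rewrite in_itv/= andbT.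
  rewrite (_ : [set y | _] = dotp z @^-1` `[cos a, +oo[)//.
  by apply/seteqP; split => y /=; rewrite in_itv/= andbT.
have e : dotp z @^-1` `]-oo, - cos b] = [set y | cos b <= dotp z' y].
  by apply/seteqP; split => y /=; rewrite in_itv/= zz' lerNr.
rewrite -(sphere_cap inv p2 (Ordinal p0) Sz'); last by apply/andP; split; lra.
by rewrite -e fineK ?fin_num_measure.
Qed.

End void_probability.

Section angle_events.
Context {R : realType}.

(** The points lie on the sphere only almost surely, so [acos] must be measurable on the whole line.
    Outside [-1, 1] it is the constant chosen by [get] from the empty set, and the endpoints are
    single points. *)
Lemma measurable_acos : measurable_fun setT (@acos R).
Proof.
have acos_out (u : R) : ~~ (-1 <= u <= 1) -> acos u = get (set0 : set R).
  move=> u1; rewrite unlock; congr get; apply/seteqP; split => y //= -[_ yu].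
  by move: u1; rewrite -yu cos_geN1 cos_le1.
have -> : [set: R] = `]-1, 1[ `|` ([set -1] `|` ([set 1] `|` ~` `[-1, 1])).
  apply/seteqP; split => u //= _; rewrite !in_itv/=.
  have [u1|u1] := boolP (-1 <= u <= 1); last by right; right; right; apply/negP.
  have [->|un1] := eqVneq u (-1); first by right; left.
  have [->|u1'] := eqVneq u 1; first by right; right; left.
  by left; move: u1 => /andP[h1 h2]; rewrite !lt_neqAle eq_sym un1 u1' h1 h2.
apply/measurable_funU => //.
  by do 2 (apply: measurableU => //); exact: measurableC.
split.
  apply: open_continuous_measurable_fun; first exact: interval_open.
  by move=> u; rewrite inE/= in_itv/=; exact: continuous_acos.
have mC : measurable (~` (`[-1, 1]%classic : set R)) by exact: measurableC.
apply/measurable_funU => //; first exact: measurableU.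
split; first exact: measurable_fun_set1.
apply/measurable_funU => //; split; first exact: measurable_fun_set1.
apply: (eq_measurable_fun (cst (get (set0 : set R)))) => //.
by move=> u; rewrite inE /= in_itv/= => /negP /acos_out.
Qed.

Lemma measurable_big_minr d (T : measurableType d) (I : Type) (s : seq I)
    (Q : pred I) (x0 : R) (f : I -> T -> R) :
  (forall i, measurable_fun setT (f i)) ->
  measurable_fun setT (fun w => \big[Num.min/x0]_(i <- s | Q i) f i w).
Proof.
move=> mf; elim: s => [|i s ih].
  by apply: (eq_measurable_fun (cst x0)) => // w _; rewrite big_nil.
apply: (eq_measurable_fun (fun w => if Q i
    then Num.min (f i w) (\big[Num.min/x0]_(i <- s | Q i) f i w)
    else \big[Num.min/x0]_(i <- s | Q i) f i w)).
  by move=> w _; rewrite big_cons.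
by case: (Q i) => //; exact: measurable_minr.
Qed.

Lemma measurable_big_maxr d (T : measurableType d) (I : Type) (s : seq I)
    (Q : pred I) (x0 : R) (f : I -> T -> R) :
  (forall i, measurable_fun setT (f i)) ->
  measurable_fun setT (fun w => \big[Num.max/x0]_(i <- s | Q i) f i w).
Proof.
move=> mf; elim: s => [|i s ih].
  by apply: (eq_measurable_fun (cst x0)) => // w _; rewrite big_nil.
apply: (eq_measurable_fun (fun w => if Q i
    then Num.max (f i w) (\big[Num.max/x0]_(i <- s | Q i) f i w)
    else \big[Num.max/x0]_(i <- s | Q i) f i w)).
  by move=> w _; rewrite big_cons.
by case: (Q i) => //; exact: measurable_maxr.
Qed.

Context d (T : measurableType d) (P : probability T R) (n p : nat)
  (X : 'I_n -> {RV P >-> p.-tuple R}).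

Lemma measurable_angle i j : measurable_fun setT (angle X i j).
Proof.
apply: (measurableT_comp measurable_acos).
have mXX : measurable_fun setT (fun w => (X i w, X j w)).
  exact: measurable_fun_pair.
exact: (measurableT_comp measurable_dotp mXX).
Qed.

Lemma measurable_norm_angle_min : measurable_fun setT (norm_angle_min X).
Proof.
apply: measurable_funB => //; apply: measurable_funM => //.
apply: measurable_funB => //; apply: measurable_big_minr => ij.
exact: measurable_angle.
Qed.

Lemma measurable_norm_angle_max : measurable_fun setT (norm_angle_max X).
Proof.
apply: measurable_funB => //; apply: measurable_funM => //.
apply: measurable_funB => //; apply: measurable_funB => //.
by apply: measurable_big_maxr => ij; exact: measurable_angle.
Qed.

(** The condition a < pi puts the default value pi of the iterated minimum on the right side of
    a. *)
Lemma lt_angle_min w a : a < pi ->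
  (a < angle_min X w) <-> (forall i j : 'I_n, (i < j)%N -> a < angle X i j w).
Proof.
move=> api; rewrite /angle_min; split=> [/bigmin_gtP[_ h] i j ij|h].
  exact: (h (i, j)).
by apply/bigmin_gtP; split => // -[i j] /= ij; exact: h.
Qed.

Lemma gt_angle_max w a : 0 < a ->
  (angle_max X w < a) <-> (forall i j : 'I_n, (i < j)%N -> angle X i j w < a).
Proof.
move=> a0; rewrite /angle_max; split=> [/bigmax_ltP[_ h] i j ij|h].
  exact: (h (i, j)).
by apply/bigmax_ltP; split => // -[i j] /= ij; exact: h.
Qed.

End angle_events.

Section tails.
Context {R : realType} (p : nat -> nat).
Hypothesis p_ge2 : forall n, (2 <= n)%N -> (2 <= p n)%N.
Context (d : nat -> measure_display) (T : forall n, measurableType (d n))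
  (P : forall n, probability (T n) R)
  (X : forall n, 'I_n -> {RV (P n) >-> (p n).-tuple R}).
Arguments X : clear implicits.
Hypothesis X_unif : forall n, (2 <= n)%N -> forall i, uniform_on_sphere (X n i).
Hypothesis X_indep : forall n, (2 <= n)%N -> mutually_independent (X n).
Hypothesis p_oo : p n @[n --> \oo] --> \oo.
Local Notation th := (@threshold R p).

Lemma lt_norm_angle_min n x w : (2 <= n)%N ->
  (x < norm_angle_min (X n) w) = (th n x < angle_min (X n) w).
Proof.
move=> n2; have a0 := alpha_gt0 (R := R) p_ge2 n2.
rewrite /norm_angle_min -/(vfactor p n) /threshold.
rewrite ltrBrDr mulrC ltr_pdivlMr// [_ * alpha_ _ _ _]mulrC.
by apply/idP/idP; lra.
Qed.

Lemma lt_norm_angle_max n x w : (2 <= n)%N ->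
  (x < norm_angle_max (X n) w) = (angle_max (X n) w < pi - th n x).
Proof.
move=> n2; have a0 := alpha_gt0 (R := R) p_ge2 n2.
rewrite /norm_angle_max -/(vfactor p n) /threshold.
rewrite ltrBrDr mulrC ltr_pdivlMr// [_ * alpha_ _ _ _]mulrC.
by apply/idP/idP; lra.
Qed.

Let q n x y : R :=
  sin_int (p n - 2) (th n x) / wallis (p n - 2) +
  sin_int (p n - 2) (th n y) / wallis (p n - 2).

Lemma measurable_tail n x y :
  measurable [set w | x < norm_angle_min (X n) w /\ y < norm_angle_max (X n) w].
Proof.
have m1 := measurable_norm_angle_min (X n).
have m2 := measurable_norm_angle_max (X n).
have h1 := m1 measurableT _ (measurable_itv `]x, +oo[).
have h2 := m2 measurableT _ (measurable_itv `]y, +oo[).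
rewrite !setTI in h1 h2; have := measurableI _ _ h1 h2.
congr measurable; apply/seteqP; split => w /=; rewrite !in_itv/= !andbT.
  by case.
by case.
Qed.

(** The two events may differ when some point is off the sphere, where [acos] no longer inverts
    cosine. They agree almost surely, hence their indicators have equal integrals. *)
Lemma tail_void n x y : (2 <= n)%N ->
  0 < th n x < pi / 2 -> 0 < th n y < pi / 2 ->
  P n [set w | x < norm_angle_min (X n) w /\ y < norm_angle_max (X n) w] =
  P n [set w | forall i j : 'I_n, (i < j)%N ->
    ~ two_caps (th n x) (th n y) (dotp (X n i w) (X n j w))].
Proof.
move=> n2 xi yi; have pi0 := pi_gt0 R.
have /andP[x0 x2] := xi; have /andP[y0 y2] := yi.
have mv : measurable [set w | forall i j : 'I_n, (i < j)%N ->
    ~ two_caps (th n x) (th n y) (dotp (X n i w) (X n j w))].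
  rewrite (_ : [set w | _] = \bigcap_(ij in [set ij : 'I_n * 'I_n | (ij.1 < ij.2)%N])
      ~` dot_event (X n) (two_caps (th n x) (th n y)) ij.1 ij.2).
    apply: fin_bigcap_measurable; first exact: finite_finset.
    move=> ij _; apply: measurableC; apply: measurable_dot_event.
    exact: measurable_two_caps.
  by apply/seteqP; split => w /= h; [move=> [i j] /=; exact: h|
    move=> i j ij; exact: (h (i, j))].
have mt := measurable_tail n x y.
have ae : {ae P n, forall w, forall i, unit_sphere (X n i w)}.
  apply: filter_forall => i; exact: (uniform_ae (X_unif n2) i).
have e : forall A, measurable A -> (P n A = \int[P n]_w (\1_A w)%:E)%E.
  by move=> A mA; rewrite integral_indic// setIT.
rewrite e// [RHS]e//; apply: ae_eq_integral => //.
- by apply/measurable_EFinP; exact: measurable_indic.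
- by apply/measurable_EFinP; exact: measurable_indic.
move: ae; apply: filterS => w Sw _; congr (_%:E); rewrite !indicE.
congr (_ %:R); congr nat_of_bool; apply/idP/idP; rewrite !inE /=.
all: rewrite lt_norm_angle_min// lt_norm_angle_max//.
all: rewrite (lt_angle_min (X n) w (a := th n x)); last by lra.
all: rewrite (gt_angle_max (X n) w (a := pi - th n y)); last by lra.
  move=> [h1 h2] i j ij.
  have /andP[l1 l2] := dotp_sphere_bound (Sw i) (Sw j).
  move: (h1 i j ij) (h2 i j ij); rewrite /angle.
  set u := dotp _ _ in l1 l2 * => g1 g2.
  have u1 : -1 <= u <= 1 by rewrite l1 l2.
  have ac : acos u \in `[0, pi] by rewrite in_itv/= acos_ge0// acos_lepi.
  have xpi : th n x \in `[0, pi] by rewrite in_itv/=; apply/andP; split; lra.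
  have ypi : pi - th n y \in `[0, pi] by rewrite in_itv/=; apply/andP; split; lra.
  have k1 : u < cos (th n x) by rewrite -[ltLHS]acosK ?in_itv// ltr_cos.
  have k2 : - cos (th n y) < u.
    have -> : - cos (th n y) = cos (pi - th n y).
      by rewrite cosB cospi sinpi mulN1r mul0r addr0.
    by rewrite -[ltRHS]acosK ?in_itv// ltr_cos.
  by rewrite /two_caps => -[]; rewrite /= in_itv/= ?andbT leNgt ?k1 ?k2.
move=> h; split => i j ij.
  have /andP[l1 l2] := dotp_sphere_bound (Sw i) (Sw j).
  have := h i j ij; rewrite /angle; set u := dotp _ _ in l1 l2 *.
  have u1 : -1 <= u <= 1 by rewrite l1 l2.
  have ac : acos u \in `[0, pi] by rewrite in_itv/= acos_ge0// acos_lepi.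
  move=> nb; rewrite -ltr_cos ?in_itv/= ?ac//; last by apply/andP; split; lra.
  rewrite acosK ?in_itv//= ltNge; apply/negP => k.
  by apply: nb; left; rewrite /= in_itv/= k.
have /andP[l1 l2] := dotp_sphere_bound (Sw i) (Sw j).
have := h i j ij; rewrite /angle; set u := dotp _ _ in l1 l2 *.
have u1 : -1 <= u <= 1 by rewrite l1 l2.
have ac : acos u \in `[0, pi] by rewrite in_itv/= acos_ge0// acos_lepi.
move=> nb; rewrite -ltr_cos ?in_itv/= ?ac//; last by apply/andP; split; lra.
rewrite cosB cospi sinpi mulN1r mul0r addr0 acosK ?in_itv//= ltNge; apply/negP => k.
by apply: nb; right; rewrite /= in_itv/= k.
Qed.

Lemma tail_cvg x y :
  fine (P n [set w | x < norm_angle_min (X n) w /\ y < norm_angle_max (X n) w])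
    @[n --> \oo] -->
  expR (- ((2 * Num.sqrt (2 * pi))^-1 * expR (x / 2))) *
  expR (- ((2 * Num.sqrt (2 * pi))^-1 * expR (y / 2))).
Proof.
have pi0 := pi_gt0 R.
have s0 : Num.sqrt (2 * pi) != 0 :> R by rewrite gt_eqF// sqrtr_gt0 mulr_gt0.
set L := (expR (x / 2) + expR (y / 2)) / Num.sqrt (2 * pi).
have -> : expR (- ((2 * Num.sqrt (2 * pi))^-1 * expR (x / 2))) *
  expR (- ((2 * Num.sqrt (2 * pi))^-1 * expR (y / 2))) = expR (- (L / 2)).
  by rewrite -expRD /L; congr expR; field.
have near_itv : \forall n \near \oo, [/\ (2 <= n)%N,
    0 < th n x < pi / 2 & 0 < th n y < pi / 2].
  near=> n; split; first by near: n; exact: nbhs_infty_ge.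
    by near: n; exact: near_threshold.
  by near: n; exact: near_threshold.
have sin_int_ge0 k a : 0 < a < pi / 2 -> 0 <= sin_int k a :> R.
  move=> /andP[a0 a2]; apply: Rintegral_ge0 => s /=; rewrite in_itv/= => /andP[? ?].
  by rewrite exprn_ge0// sin_ge0_pi//; apply/andP; split; lra.
(* [cvg_birthday_prod] wants nonnegativity at every rank, whereas the thresholds are known to be
   acute only eventually. *)
pose q' n := Num.max 0 (q n x y).
have near_q : \forall n \near \oo, q n x y = q' n.
  apply: filterS near_itv => n [n2 xi yi]; rewrite /q' max_r//.
  have w0 : 0 <= wallis (p n - 2) :> R by rewrite ltW// wallis_gt0.
  by apply: addr_ge0; apply: divr_ge0 => //; exact: sin_int_ge0.
have q'L : n%:R ^+ 2 * q' n @[n --> \oo] --> L.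
  apply: (@cvg_near_eq _ (fun n => n%:R ^+ 2 *
        (sin_int (p n - 2) (th n x) / wallis (p n - 2)) +
      n%:R ^+ 2 * (sin_int (p n - 2) (th n y) / wallis (p n - 2)))).
    by apply: filterS near_q => n <-; rewrite -mulrDr.
  by rewrite /L mulrDl; apply: cvgD; exact: cap_asymptotics.
have q'_ge0 n : 0 <= q' n by rewrite le_max lexx.
have [prod_cvg nq n3] := cvg_birthday_prod q'_ge0 q'L.
apply: (@squeeze_cvgr _ _ _ _ (fun n => \prod_(i < n) (1 - i%:R * q' n))
  (fun n => \prod_(i < n) (1 - i%:R * q' n) +
    n%:R * (n%:R ^+ 2 * (q' n * q' n)))) => //; last first.
  by rewrite -[X in _ --> X]addr0; exact: cvgD.
near=> n.
have [n2 xi yi] : [/\ (2 <= n)%N,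
    0 < th n x < pi / 2 & 0 < th n y < pi / 2] by near: n; exact: near_itv.
rewrite tail_void//.

have nq1 : n%:R * q' n <= 1 by near: n; apply: (cvgr_le _ nq).
apply: (void_bounds (X_unif n2) (X_indep n2)) => //.
  exact: measurable_two_caps.
move=> k z Sz; rewrite two_caps_law ?p_ge2//.
  by rewrite -/(q n x y) (near near_q n).
exact: X_unif.
Unshelve. all: by end_near. Qed.

End tails.

(** * Weak convergence in the plane *)

Section plane_functions.
Context {R : realType}.

(** The plane carries the product sigma-algebra, so an open set is written as a countable union of
    boxes with rational centres. *)
Lemma open_measurable_plane (U : set (R * R)) : open U -> measurable U.
Proof.
move=> oU.
pose box q r n : set (R * R) :=
  ball (ratr q : R) n.+1%:R^-1 `*` ball (ratr r : R) n.+1%:R^-1.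
have -> : U = \bigcup_(q : rat) \bigcup_(r : rat) \bigcup_(n : nat)
    (if `[< box q r n `<=` U >] then box q r n else set0).
  apply/seteqP; split => [[u1 u2] Uu|u]; last first.
    by move=> [q _ [r _ [n _]]]; case: ifPn => // /asboolP + ?; apply.
  have /nbhs_ballP[e /= e0 eU] := open_nbhs_nbhs (conj oU Uu).
  have [n ne] : exists n, n.+1%:R^-1 < e / 2.
    have : \forall n \near \oo, n.+1%:R^-1 < e / 2.
      by apply: (cvgr_lt _ (@cvg_harmonic R)); rewrite divr_gt0.
    by move=> [n _ /(_ n (leqnn n))]; exists n.
  have n0 : 0 < n.+1%:R^-1 :> R by rewrite invr_gt0.
  have [q qu] : exists q : rat, `|ratr q - u1| < n.+1%:R^-1.
    have [q] := @rat_in_itvoo R u1 (u1 + n.+1%:R^-1) ltac:(by rewrite ltrDl).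
    rewrite in_itv/= => /andP[h1 h2]; exists q.
    by rewrite gtr0_norm ?subr_gt0// ltrBlDl.
  have [r ru] : exists r : rat, `|ratr r - u2| < n.+1%:R^-1.
    have [r] := @rat_in_itvoo R u2 (u2 + n.+1%:R^-1) ltac:(by rewrite ltrDl).
    rewrite in_itv/= => /andP[h1 h2]; exists r.
    by rewrite gtr0_norm ?subr_gt0// ltrBlDl.
  exists q => //; exists r => //; exists n => //.
  rewrite ifT; first by split.
  apply/asboolP => -[v1 v2] [/= b1 b2]; apply: eU; split => /=.
    apply: (le_lt_trans (ler_distD (ratr q) u1 v1)).
    rewrite [ltRHS]splitr ltrD// ?(lt_trans b1)// distrC; exact: lt_trans ne.
  apply: (le_lt_trans (ler_distD (ratr r) u2 v2)).
  rewrite [ltRHS]splitr ltrD// ?(lt_trans b2)// distrC; exact: lt_trans ne.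
apply: bigcupT_measurable_rat => q; apply: bigcupT_measurable_rat => r.
apply: bigcupT_measurable => n; case: ifPn => // _.
by apply: measurableX; exact: measurable_ball.
Qed.

Lemma continuous_measurable_plane (f : R * R -> R) : continuous f ->
  measurable_fun setT f.
Proof.
move=> cf; apply: (measurability _ (RGenOInfty.measurableE R)) => //.
move=> _ [_ [a ->] <-]; rewrite setTI; apply: open_measurable_plane.
by move/continuousP : cf; apply; exact: rray_open.
Qed.

(** Uniform continuity where only one of the two points must lie in the compact box: cells at its
    edge need no special treatment. The radius is obtained by compactness, along the filter of
    positive reals tending to 0. *)
Lemma continuous_box_uniform (f : R * R -> R) (K e : R) : continuous f -> 0 < e ->
  exists2 r, 0 < r & forall u v : R * R, `|u.1| <= K -> `|u.2| <= K ->
    `|u.1 - v.1| < r -> `|u.2 - v.2| < r -> `|f u - f v| <= e.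
Proof.
move=> cf e0.
pose box : set (R * R) := `[-K, K] `*` `[-K, K].
have cbox : compact box by apply: compact_setX; exact: segment_compact.
pose Q (r : R) (u : R * R) := forall v : R * R, `|u.1 - v.1| < r ->
  `|u.2 - v.2| < r -> `|f u - f v| <= e.
have /compact_near_coveringP/(_ _ (0 : R)^'+ Q _) := cbox.
case.
- move=> x _; have e2 : 0 < e / 2 by rewrite divr_gt0.
  have /cvgrPdist_le/(_ _ e2) := cf x; move=> /nbhs_ballP[r /= r0 fr].
  exists (ball x (r / 2), [set s | 0 < s < r / 2]) => /=.
    split; first by apply: nbhsx_ballx; rewrite divr_gt0.
    near=> s => /=; apply/andP; split; first by near: s; exact: nbhs_right_gt.
    by near: s; apply: nbhs_right_lt; rewrite divr_gt0.
  move=> [u s] /= [[xu1 xu2] /andP[s0 sr]] v uv1 uv2.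
  have rr : r / 2 < r by rewrite ltr_pdivrMr// ltr_pMr// ltr1n.
  have fu : `|f x - f u| <= e / 2.
    by apply: fr; split; [exact: lt_trans rr|exact: lt_trans rr].
  have fv : `|f x - f v| <= e / 2.
    apply: fr; split.
      apply: (le_lt_trans (ler_distD u.1 x.1 v.1)).
      by rewrite [ltRHS]splitr ltrD// (lt_trans uv1).
    apply: (le_lt_trans (ler_distD u.2 x.2 v.2)).
    by rewrite [ltRHS]splitr ltrD// (lt_trans uv2).
  apply: (le_trans (ler_distD (f x) (f u) (f v))).
  by rewrite [leRHS]splitr lerD// distrC.
- move=> r /= r0 h.
  have r2 : 0 < r / 2 by rewrite divr_gt0.
  exists (r / 2) => // u v u1 u2; apply: (h (r / 2)) => //=.
    by rewrite sub0r normrN gtr0_norm// ltr_pdivrMr// ltr_pMr// ltr1n.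
  by split; rewrite /= in_itv/= -ler_norml.
Unshelve. all: by end_near. Qed.

End plane_functions.

Section step_functions.
Context {R : realType}.
Implicit Types (a u : R).

(** The strict inequality makes the mean of a product of two steps a joint tail, and differences of
    steps indicators of cells ]a, b] that tile exactly. *)
Definition step a u : R := (a < u)%R%:R.

Lemma measurable_step a : measurable_fun setT (step a).
Proof.
rewrite (_ : step a = \1_(`]a, +oo[%classic)); first exact: measurable_indic.
by apply/funext => u; rewrite indicE mem_setE in_itv/= andbT.
Qed.

Lemma step_bound a u : 0 <= step a u <= 1.
Proof. by rewrite /step ler0n lern1; case: (a < u). Qed.

Lemma step_le a b u : a <= b -> step b u <= step a u.
Proof.
move=> ab; rewrite /step ler_nat; case: (ltP b u) => // bu.
by rewrite (le_lt_trans ab bu).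
Qed.

Lemma stepB_neq0 a b u : a <= b -> step a u - step b u != 0 -> a < u <= b.
Proof.
move=> ab; rewrite /step; case: (ltP b u) => bu; last first.
  by case: (a < u); rewrite ?subrr ?eqxx.
by rewrite (le_lt_trans ab bu) subrr eqxx.
Qed.

Definition tame (h : R -> R -> R) :=
  measurable_fun setT (fun u : R * R => h u.1 u.2) /\
  exists M, forall u v, `|h u v| <= M.

Lemma tame_step a b : tame (fun u v => step a u * step b v).
Proof.
split; last first.
  exists 1 => u v; have /andP[h1 h2] := step_bound a u.
  by have /andP[h3 h4] := step_bound b v; rewrite ger0_norm ?mulr_ge0// mulr_ile1.
apply: measurable_funM.
  exact: (measurableT_comp (measurable_step a) measurable_fst).
exact: (measurableT_comp (measurable_step b) measurable_snd).
Qed.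

Lemma tame_cst c : tame (fun _ _ => c).
Proof. by split => //; exists `|c|. Qed.

Lemma tameD h k : tame h -> tame k -> tame (fun u v => h u v + k u v).
Proof.
move=> [mh [M hM]] [mk [N kN]]; split; first exact: measurable_funD.
by exists (M + N) => u v; rewrite (le_trans (ler_normD _ _))// lerD.
Qed.

Lemma tameZ c h : tame h -> tame (fun u v => c * h u v).
Proof.
move=> [mh [M hM]]; split; first exact: measurable_funM.
by exists (`|c| * M) => u v; rewrite normrM ler_wpM2l.
Qed.

Context d (T : measurableType d) (P : probability T R).

Definition mean (Y1 Y2 : T -> R) (h : R -> R -> R) : R :=
  \int[P]_w h (Y1 w) (Y2 w).

Variables (Y1 Y2 : T -> R).
Hypotheses (mY1 : measurable_fun setT Y1) (mY2 : measurable_fun setT Y2).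

Lemma tame_integrable h : tame h ->
  P.-integrable setT (EFin \o (fun w => h (Y1 w) (Y2 w))).
Proof.
move=> [mh [M hM]]; apply: measurable_bounded_integrable => //.
- by rewrite [X in (X < _)%E]probability_setT ltry.
- exact: (measurableT_comp mh (measurable_fun_pair mY1 mY2)).
- exists M; split; rewrite ?num_real// => N MN x _ /=.
  by rewrite (le_trans (hM _ _))// ltW.
Qed.

Lemma meanD h k : tame h -> tame k ->
  mean Y1 Y2 (fun u v => h u v + k u v) = mean Y1 Y2 h + mean Y1 Y2 k.
Proof. by move=> th tk; rewrite /mean RintegralD//; exact: tame_integrable. Qed.

Lemma meanZ c h : tame h ->
  mean Y1 Y2 (fun u v => c * h u v) = c * mean Y1 Y2 h.
Proof. by move=> th; rewrite /mean RintegralZl//; exact: tame_integrable. Qed.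

Lemma mean_step a b : mean Y1 Y2 (fun u v => step a u * step b v) =
  fine (P [set w | a < Y1 w /\ b < Y2 w]).
Proof.
have mA : measurable [set w | a < Y1 w /\ b < Y2 w].
  have h1 := mY1 measurableT (measurable_itv `]a, +oo[).
  have h2 := mY2 measurableT (measurable_itv `]b, +oo[).
  rewrite !setTI in h1 h2; have := measurableI _ _ h1 h2.
  by congr measurable; apply/seteqP; split => w /=; rewrite !in_itv/= !andbT; case.
rewrite -[in RHS](setIT [set w | _]) -integral_indic//; congr fine.
apply: eq_integral => w _; rewrite indicE /step -natrM mulnb; congr (_%:R%:E).
by congr nat_of_bool; apply/idP/idP; rewrite inE /= => /andP.
Qed.

Lemma mean_cst c : mean Y1 Y2 (fun _ _ => c) = c.
Proof. by rewrite /mean Rintegral_cst// [X in fine X]probability_setT mulr1. Qed.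

Lemma mean_dist f s b (e M : R) : tame f -> tame s -> tame b ->
  (forall u v, `|f u v - s u v| <= e + M * (1 - b u v)) ->
  `|mean Y1 Y2 f - mean Y1 Y2 s| <= e + M * (1 - mean Y1 Y2 b).
Proof.
move=> tf ts tb fs.
have tD : tame (fun u v => f u v + -1 * s u v) by apply: tameD => //; exact: tameZ.
have tE : tame (fun u v => (e + M) + - M * b u v).
  by apply: tameD; [exact: tame_cst|exact: tameZ].
have -> : mean Y1 Y2 f - mean Y1 Y2 s = mean Y1 Y2 (fun u v => f u v + -1 * s u v).
  by rewrite meanD ?meanZ//; [ring|exact: tameZ].
have -> : e + M * (1 - mean Y1 Y2 b) = mean Y1 Y2 (fun u v => (e + M) + - M * b u v).
  rewrite meanD; [|exact: tame_cst|exact: tameZ].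
  by rewrite meanZ// mean_cst; ring.
apply: (le_trans (le_normr_Rintegral _ (tame_integrable tD))) => //.
apply: le_Rintegral => //; last first.
- move=> w _; rewrite mulN1r (le_trans (fs _ _))//; lra.
- exact: (tame_integrable tE).
- exact: (integrable_norm (tame_integrable tD)).
Qed.

End step_functions.

Section grid.
Context {R : realType} (f : R * R -> R) (K eps M : R) (N : nat).
Hypotheses (K0 : 0 < K) (eps0 : 0 <= eps) (fM : forall u, `|f u| <= M).
Let a i : R := - K + i%:R * (2 * K / N.+1%:R).
Let D i u : R := step (a i) u - step (a i.+1) u.
Hypothesis f_unif : forall u v : R * R, `|u.1| <= K -> `|u.2| <= K ->
  `|u.1 - v.1| <= 2 * K / N.+1%:R -> `|u.2 - v.2| <= 2 * K / N.+1%:R ->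
  `|f u - f v| <= eps.

Definition grid_step (u v : R) : R :=
  \sum_(i < N.+1) \sum_(j < N.+1) f (a i.+1, a j.+1) * (D i u * D j v).

Definition in_box (u v : R) : R :=
  (step (- K) u - step K u) * (step (- K) v - step K v).

Let mesh0 : 0 <= 2 * K / N.+1%:R.
Proof. by rewrite divr_ge0// mulr_ge0// ltW. Qed.

Let aS i : a i.+1 = a i + 2 * K / N.+1%:R.
Proof. by rewrite /a -natr1 mulrDl mul1r addrA. Qed.

Let a_le i : a i <= a i.+1.
Proof. by rewrite aS lerDl. Qed.

Let D_ge0 i u : 0 <= D i u.
Proof. by rewrite subr_ge0 step_le. Qed.

Let sumD u : \sum_(i < N.+1) D i u = step (- K) u - step K u.
Proof.
rewrite -(big_mkord xpredT (D^~ u)).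
rewrite (@telescope_sumr_eq _ 0 N.+1 (fun i => - step (a i) u))//; last first.
  by move=> k _; rewrite /D addrC opprK.
rewrite opprK addrC /a mul0r addr0; congr (_ - step _ _).
by field; rewrite addr_eq0 gt_eqF// (lt_le_trans _ (ler0n _ _)) ?ltrN10.
Qed.

Let in_boxE u v : in_box u v = \sum_(i < N.+1) \sum_(j < N.+1) D i u * D j v.
Proof.
rewrite /in_box -!sumD mulr_suml; apply: eq_bigr => i _.
by rewrite mulr_sumr.
Qed.

Let D_close i u : (i < N.+1)%N -> D i u != 0 ->
  `|u| <= K /\ `|u - a i.+1| <= 2 * K / N.+1%:R.
Proof.
move=> iN /(stepB_neq0 (a_le i)) /andP[h1 h2].
have N0 : 0 < N.+1%:R :> R by [].
have ai : - K <= a i by rewrite lerDl mulr_ge0.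
have ai1 : a i.+1 <= K.
  have -> : K = - K + N.+1%:R * (2 * K / N.+1%:R) by field; rewrite gt_eqF.
  by rewrite lerD2l ler_wpM2r// ler_nat.
move: (aS i) ai ai1 h1 h2; move: (a i) (a i.+1) (2 * K / N.+1%:R).
move=> b c e be Kb cK bu uc.
by split; rewrite ler_norml; apply/andP; split; lra.
Qed.

(** Inside the box the cells partition the indicator and f varies by at most eps on each; outside,
    [grid_step] is 0 and |f| <= M. *)
Lemma grid_dist u v :
  `|f (u, v) - grid_step u v| <= eps + M * (1 - in_box u v).
Proof.
have B0 : 0 <= in_box u v.
  by rewrite in_boxE; apply: sumr_ge0 => i _; apply: sumr_ge0 => j _; exact: mulr_ge0.
have st x : 0 <= step (- K) x - step K x <= 1.
  have KK : - K <= K by move: K0; lra.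
  rewrite subr_ge0 step_le//=.
  by have /andP[_ h] := step_bound (- K) x; have /andP[h' _] := step_bound K x; lra.
have B1 : in_box u v <= 1.
  have /andP[? ?] := st u; have /andP[? ?] := st v; exact: mulr_ile1.
have -> : f (u, v) - grid_step u v = f (u, v) * (1 - in_box u v) +
    \sum_(i < N.+1) \sum_(j < N.+1)
      (f (u, v) - f (a i.+1, a j.+1)) * (D i u * D j v).
  have -> : \sum_(i < N.+1) \sum_(j < N.+1)
      (f (u, v) - f (a i.+1, a j.+1)) * (D i u * D j v) =
      f (u, v) * in_box u v - grid_step u v.
    rewrite in_boxE /grid_step mulr_sumr -sumrB; apply: eq_bigr => i _.
    by rewrite mulr_sumr -sumrB; apply: eq_bigr => j _; rewrite mulrBl.
  by ring.
apply: (le_trans (ler_normD _ _)); rewrite addrC lerD//; last first.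
  rewrite normrM (ger0_norm (_ : 0 <= 1 - in_box u v)) ?subr_ge0//.
  by rewrite ler_wpM2r ?subr_ge0.
apply: (@le_trans _ _ (eps * in_box u v)); last by rewrite ler_piMr.
rewrite in_boxE mulr_sumr (le_trans (ler_norm_sum _ _ _))//.
apply: ler_sum => i _; rewrite mulr_sumr (le_trans (ler_norm_sum _ _ _))//.
apply: ler_sum => j _; rewrite normrM (ger0_norm (mulr_ge0 _ _))//.
have [D1|D1] := eqVneq (D i u) 0; first by rewrite D1 !mul0r !mulr0.
have [D2|D2] := eqVneq (D j v) 0; first by rewrite D2 !mulr0.
have [u1 u2] := D_close (ltn_ord i) D1; have [v1 v2] := D_close (ltn_ord j) D2.
by rewrite ler_wpM2r ?mulr_ge0//; apply: f_unif.
Qed.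

End grid.

Section weak_convergence.
Context {R : realType} (d : nat -> measure_display)
  (T : forall n, measurableType (d n)) (P : forall n, probability (T n) R)
  (Y1 Y2 : forall n, T n -> R) d' (S : measurableType d') (Q : probability S R)
  (Z1 Z2 : S -> R).
Arguments Y1 : clear implicits.
Arguments Y2 : clear implicits.
Hypotheses (mY1 : forall n, measurable_fun setT (Y1 n))
  (mY2 : forall n, measurable_fun setT (Y2 n))
  (mZ1 : measurable_fun setT Z1) (mZ2 : measurable_fun setT Z2).
Hypothesis tails : forall x y,
  fine (P n [set w | x < Y1 n w /\ y < Y2 n w]) @[n --> \oo] -->
  fine (Q [set w | x < Z1 w /\ y < Z2 w]).

(** A class closed under linear combinations that contains the products of steps by [tails], hence
    also [grid_step] and [in_box]. *)
Let good (h : R -> R -> R) := tame h /\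
  (mean (P n) (Y1 n) (Y2 n) h @[n --> \oo] --> mean Q Z1 Z2 h).

Let good_step a b : good (fun u v => step a u * step b v).
Proof.
split; first exact: tame_step.
rewrite mean_step//; under eq_fun do rewrite mean_step//.
exact: tails.
Qed.

Let goodD h k : good h -> good k -> good (fun u v => h u v + k u v).
Proof.
move=> [th ch] [tk ck]; split; first exact: tameD.
rewrite meanD//; under eq_fun do rewrite meanD//.
exact: cvgD.
Qed.

Let goodZ c h : good h -> good (fun u v => c * h u v).
Proof.
move=> [th ch]; split; first exact: tameZ.
rewrite meanZ//; under eq_fun do rewrite meanZ//.
by apply: cvgM => //; exact: cvg_cst.
Qed.

Let good0 : good (fun _ _ => 0).
Proof.
have := goodZ 0 (good_step 0 0); congr good.
by apply/funext => u; apply/funext => v; rewrite mul0r.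
Qed.

Let good_sum (I : Type) (s : seq I) (h : I -> R -> R -> R) :
  (forall i, good (h i)) -> good (fun u v => \sum_(i <- s) h i u v).
Proof.
move=> gh; elim: s => [|i s ih].
  rewrite (_ : (fun _ _ => _) = (fun _ _ => 0))//.
  by apply/funext => u; apply/funext => v; rewrite big_nil.
rewrite (_ : (fun _ _ => _) = (fun u v => h i u v + \sum_(i <- s) h i u v)).
  exact: goodD.
by apply/funext => u; apply/funext => v; rewrite big_cons.
Qed.

Let good_rect a b a' b' :
  good (fun u v => (step a u - step b u) * (step a' v - step b' v)).
Proof.
rewrite (_ : (fun _ _ => _) = (fun u v =>
  (step a u * step a' v + -1 * (step b u * step a' v)) +
  (-1 * (step a u * step b' v) + step b u * step b' v))).
  apply: goodD; apply: goodD => //; try exact: good_step.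
    exact/goodZ/good_step.
  exact/goodZ/good_step.
by apply/funext => u; apply/funext => v; ring.
Qed.

(** Tightness of the limit alone; that of the converging laws follows because [in_box] is [good]. *)
Let box_mean : mean Q Z1 Z2 (in_box k%:R) @[k --> \oo] --> (1 : R).
Proof.
rewrite -[X in _ --> X](mean_cst Q Z1 Z2).
apply: (@Rintegral_dominated _ _ _ Q setT _ _ (fun=> 1)) => //.
- move=> k; have [[mb _] _] := good_rect (- k%:R) k%:R (- k%:R) k%:R.
  exact: (measurableT_comp mb (measurable_fun_pair mZ1 mZ2)).
- exact: finite_measure_integrable_cst.
- move=> w _; apply: (@cvg_near_eq _ (fun=> 1)); last exact: cvg_cst.
  near=> k.
  have h (z : R) : `|z| < k%:R -> step (- k%:R) z - step k%:R z = 1.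
    by rewrite ltr_norml /step => /andP[h1 h2]; rewrite h1 ltNge (ltW h2) subr0.
  rewrite /in_box !h ?mulr1//; near: k; exact: nbhs_infty_gtr.
- move=> k w _; rewrite /in_box.
  have st x : `|step (- k%:R) x - step k%:R x| <= 1.
    have /andP[? ?] := step_bound (- k%:R) x; have /andP[? ?] := step_bound k%:R x.
    by rewrite ler_norml; apply/andP; split; lra.
  by rewrite normrM mulr_ile1 ?normr_ge0 ?st.
Unshelve. all: by end_near. Qed.

Lemma cvg_in_distribution_tails : cvg_in_distribution P
  (fun n w => (Y1 n w, Y2 n w)) Q (fun w => (Z1 w, Z2 w)).
Proof.
move=> f cf [M0 fM0].
pose M := `|M0| + 1.
have M1 : 1 <= M by rewrite lerDr.
have fM u : `|f u| <= M.
  by rewrite (le_trans (fM0 u))// (le_trans (ler_norm _))// lerDl.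
pose F u v := f (u, v).
have tF : tame F.
  split; last by exists M => u v; exact: fM.
  rewrite (_ : (fun _ => _) = f); first exact: continuous_measurable_plane.
  by apply/funext => -[].
have EE dd (V : measurableType dd) (W : probability V R) (U1 U2 : V -> R) :
    measurable_fun setT U1 -> measurable_fun setT U2 ->
    ('E_W[f \o (fun w => (U1 w, U2 w))] = (mean W U1 U2 F)%:E)%E.
  move=> m1 m2; rewrite unlock /mean /Rintegral fineK//.
  by apply: integrable_fin_num => //; exact: (tame_integrable W m1 m2 tF).
rewrite EE//; under eq_fun do rewrite EE//.
apply: cvg_EFin; first exact: nearW.
apply/cvgrPdist_le => e e0.
(* The budget is dl + M dl for the limit, dl between the two grid means, and dl + 2 M dl at rank n,
   where the mass outside the box is at most 2 dl. *)
pose dl := e / (3 + 3 * M).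
have dl0 : 0 < dl by rewrite divr_gt0//; lra.
have [k [k0 kbox]] : exists k : nat, (0 < k)%N /\ 1 - dl <= mean Q Z1 Z2 (in_box k%:R).
  have : \forall k \near \oo, (0 < k)%N /\ 1 - dl <= mean Q Z1 Z2 (in_box k%:R).
    near=> k; split; first by near: k; exact: nbhs_infty_gt.
    by near: k; apply: (cvgr_ge _ box_mean); lra.
  by move=> [k _ /(_ k (leqnn k))]; exists k.
have K0 : 0 < k%:R :> R by rewrite ltr0n.
have [r r0 fr] := continuous_box_uniform k%:R cf dl0.
have [N Nr] : exists N, 2 * k%:R / N.+1%:R < r.
  have h : 2 * k%:R * N.+1%:R^-1 @[N --> \oo] --> (2 * k%:R * 0 : R).
    by apply: cvgM; [exact: cvg_cst|exact: cvg_harmonic].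
  rewrite mulr0 in h; have [N _ /(_ N (leqnn N))] := cvgr_lt _ h _ r0.
  by exists N.
have unif (u v : R * R) : `|u.1| <= k%:R -> `|u.2| <= k%:R ->
    `|u.1 - v.1| <= 2 * k%:R / N.+1%:R -> `|u.2 - v.2| <= 2 * k%:R / N.+1%:R ->
    `|f u - f v| <= dl.
  by move=> u1 u2 v1 v2; apply: fr => //; exact: le_lt_trans Nr.
have gS : good (grid_step f k%:R N).
  by apply: good_sum => i; apply: good_sum => j; exact/goodZ/good_rect.
have gB : good (in_box k%:R) by exact: good_rect.
have dist u v := grid_dist K0 (ltW dl0) fM unif u v.
have [tS cS] := gS; have [tB cB] := gB.
near=> n.
have hQ := mean_dist Q mZ1 mZ2 tF tS tB dist.
have hn := mean_dist (P n) (@mY1 n) (@mY2 n) tF tS tB dist.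
have hS : `|mean Q Z1 Z2 (grid_step f k%:R N) -
    mean (P n) (Y1 n) (Y2 n) (grid_step f k%:R N)| <= dl.
  by near: n; move/cvgrPdist_le : cS; apply.
have hB : 1 - 2 * dl <= mean (P n) (Y1 n) (Y2 n) (in_box k%:R).
  by near: n; apply: (cvgr_ge _ cB); lra.
have eE : e = dl + M * dl + dl + (dl + M * (2 * dl)).
  by rewrite /dl; field; rewrite gt_eqF//; lra.
have M0' : 0 <= M by lra.
have hQ' := ler_wpM2l M0' kbox; have hB' := ler_wpM2l M0' hB.
rewrite distrC in hQ.
apply: (le_trans (ler_distD (mean Q Z1 Z2 (grid_step f k%:R N)) _ _)).
move: hQ; rewrite distrC => hQ.
apply: (le_trans (lerD (le_refl _) (ler_distD
  (mean (P n) (Y1 n) (Y2 n) (grid_step f k%:R N)) _ _))).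
rewrite [X in _ + (_ + X)]distrC; move: hQ hn hS hQ' hB'.
rewrite eE; lra.
Unshelve. all: by end_near. Qed.

End weak_convergence.

(** * The limit law *)

Section limit_law.
Context {R : realType}.
Let c : R := (2 * Num.sqrt (2 * pi))^-1.

Let c_gt0 : 0 < c.
Proof. by rewrite invr_gt0 mulr_gt0// sqrtr_gt0 mulr_gt0// pi_gt0. Qed.

Let cdf_nd : nondecreasing (@limit_cdf R).
Proof.
move=> x y xy; rewrite /limit_cdf -/c lerD2l lerN2 ler_expR lerN2.
by rewrite ler_wpM2l ?(ltW c_gt0)// ler_expR ler_wpM2r.
Qed.

Let expR_half_cont : continuous (fun x : R => expR (x / 2)).
Proof.
move=> x; apply: cvg_continuous_comp; first exact: continuous_expR.
by apply: cvgM; [exact: cvg_id|exact: cvg_cst].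
Qed.

Lemma cvg_limit_cdf (F : set_system R) {FF : Filter F} (l : R) :
  expR (x / 2) @[x --> F] --> l ->
  limit_cdf x @[x --> F] --> 1 - expR (- (c * l)).
Proof.
move=> h; apply: cvgB; first exact: cvg_cst.
apply: cvg_continuous_comp; first exact: continuous_expR.
by apply: cvgN; apply: cvgM; [exact: cvg_cst|exact: h].
Qed.

Let cdf_rc : right_continuous (@limit_cdf R).
Proof.
apply: right_continuousW => x.
have := cvg_limit_cdf (expR_half_cont (x := x)). exact.
Qed.

HB.instance Definition _ :=
  isCumulative.Build R _ R (@limit_cdf R) cdf_nd cdf_rc.

Let cdf_Ny : @limit_cdf R @ -oo --> (0 : R).
Proof.
have h : expR (x / 2) @[x --> -oo%R] --> (0 : R).
  apply/cvgr0Pnorm_le => e e0; near=> x.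
  rewrite ger0_norm ?expR_ge0// -[leRHS]lnK ?posrE// ler_expR.
  rewrite ler_pdivrMr//; near: x; exact: nbhs_ninfty_le.
have := cvg_limit_cdf h; rewrite mulr0 oppr0 expR0 subrr; exact.
Unshelve. all: by end_near. Qed.

Let cdf_y : @limit_cdf R @ +oo --> (1 : R).
Proof.
apply/cvgrPdist_le => e e0; near=> x.
rewrite /limit_cdf -/c opprB addrCA subrr addr0 ger0_norm ?expR_ge0//.
rewrite -[leRHS]lnK ?posrE// ler_expR lerNl -ler_pdivrMl//.
have h : 1 + x / 2 <= expR (x / 2) by exact: expR_ge1Dx.
apply: le_trans h; suff : 2 * (c^-1 * - ln e) <= x by lra.
by near: x; apply: nbhs_pinfty_ge; rewrite num_real.
Unshelve. all: by end_near. Qed.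

HB.instance Definition _ :=
  isCumulativeBounded.Build R 0 1 (@limit_cdf R) cdf_Ny cdf_y.

(** A probability because [limit_cdf] is nondecreasing and right-continuous with limits 0 and 1. *)
Definition limit_law : probability (measurableTypeR R) R :=
  lebesgue_stieltjes_measure (@limit_cdf R).

Lemma limit_lawE (x : R) : limit_law `]-oo, x]%classic = (limit_cdf x)%:E.
Proof. exact: (@cdf_lebesgue_stieltjes_id R (@limit_cdf R)). Qed.

Lemma limit_law_tail (x : R) :
  limit_law `]x, +oo[%classic = (expR (- (c * expR (x / 2))))%:E.
Proof.
rewrite -setCitvl probability_setC// limit_lawE /limit_cdf -/c.
by rewrite -EFinB opprB addrCA subrr addr0.
Qed.

Definition limit_pair : probability (measurableTypeR R * measurableTypeR R)%type R :=
  (limit_law \x limit_law)%E.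

Lemma limit_pairE (A B : set R) : measurable A -> measurable B ->
  limit_pair (A `*` B) = (limit_law A * limit_law B)%E.
Proof. by move=> mA mB; rewrite /limit_pair/= product_measure1E. Qed.

End limit_law.

Section marginals.
Context {R : realType}.
Local Notation Q := (@limit_pair R).

Let fst_R (z : measurableTypeR R * measurableTypeR R) : R := z.1.
Let snd_R (z : measurableTypeR R * measurableTypeR R) : R := z.2.

Let measurable_fst_R : measurable_fun setT fst_R.
Proof. exact: measurable_fst. Qed.

Let measurable_snd_R : measurable_fun setT snd_R.
Proof. exact: measurable_snd. Qed.

Definition limit_fst : {RV Q >-> R} :=
  HB.pack fst_R (isMeasurableFun.Build _ _ _ _ fst_R measurable_fst_R).

Definition limit_snd : {RV Q >-> R} :=
  HB.pack snd_R (isMeasurableFun.Build _ _ _ _ snd_R measurable_snd_R).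

Lemma limit_fstE (A : set R) : measurable A ->
  Q (limit_fst @^-1` A) = limit_law A.
Proof.
move=> mA; rewrite (_ : _ @^-1` A = A `*` setT); last first.
  by apply/seteqP; split => -[u v] //= [].
by rewrite limit_pairE// probability_setT mule1.
Qed.

Lemma limit_sndE (A : set R) : measurable A ->
  Q (limit_snd @^-1` A) = limit_law A.
Proof.
move=> mA; rewrite (_ : _ @^-1` A = setT `*` A); last first.
  by apply/seteqP; split => -[u v] //= [].
by rewrite limit_pairE// probability_setT mul1e.
Qed.

Lemma limit_independent : independent2 limit_fst limit_snd.
Proof.
move=> A B mA mB; rewrite limit_fstE// limit_sndE// -limit_pairE//.
Qed.

Lemma limit_pair_tail (x y : R) :
  Q [set w | x < limit_fst w /\ y < limit_snd w] =
  (expR (- ((2 * Num.sqrt (2 * pi))^-1 * expR (x / 2))) *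
   expR (- ((2 * Num.sqrt (2 * pi))^-1 * expR (y / 2))))%:E.
Proof.
rewrite EFinM -!limit_law_tail -limit_pairE//; congr (Q _).
by apply/seteqP; split => -[u v] /=; rewrite !in_itv/= !andbT.
Qed.

End marginals.

Theorem theorem2p1 (R : realType) (p : nat -> nat)
  (p_ge2 : forall n, (2 <= n)%N -> (2 <= p n)%N)
  (d : nat -> measure_display) (T : forall n, measurableType (d n))
  (P : forall n, probability (T n) R)
  (X : forall n, 'I_n -> {RV (P n) >-> (p n).-tuple R})
  (X_unif : forall n, (2 <= n)%N -> forall i, uniform_on_sphere (X n i))
  (X_indep : forall n, (2 <= n)%N -> mutually_independent (X n))
  (p_oo : p n @[n --> \oo] --> \oo) :
  exists (d' : measure_display) (S : measurableType d') (Q : probability S R)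
         (Z1 Z2 : {RV Q >-> R}),
    [/\ independent2 Z1 Z2,
        forall x, cdf Z1 x = (limit_cdf x)%:E,
        forall x, cdf Z2 x = (limit_cdf x)%:E &
        cvg_in_distribution P
          (fun n w => (norm_angle_min (X n) w, norm_angle_max (X n) w))
          Q (fun w => (Z1 w, Z2 w))].
Proof.
(* The limit is realized on the plane by the square of [limit_law], whose coordinates are
   independent. *)
exists _, _, (@limit_pair R), limit_fst, limit_snd; split.
- exact: limit_independent.
- by move=> x; rewrite /cdf /distribution /pushforward limit_fstE// limit_lawE.
- by move=> x; rewrite /cdf /distribution /pushforward limit_sndE// limit_lawE.
- have := @cvg_in_distribution_tails R d T P
    (fun n => norm_angle_min (X n)) (fun n => norm_angle_max (X n)).
  apply => //.
  + by move=> n; exact: measurable_norm_angle_min.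
  + by move=> n; exact: measurable_norm_angle_max.
  + move=> x y; rewrite limit_pair_tail.
    exact: tail_cvg.
Qed.
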